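(* Let $X$ be a quasi-coherent integral log scheme, i.e. $X$ admits integral charts Zariski locally. Suppose that $x' \rightsquigarrow x$ is a specialization of points in $X$. Then there exist a log valuation ring $(V,P)$, with maximal ideal $\mathfrak{m}\subset V$, and a morphism of log schemes $\operatorname{Spec}(V,P)\to X$ which lifts the specialization, i.e. which sends the generic point $(0)$ of $\operatorname{Spec} V$ to $x'$ and the closed point $\mathfrak{m}$ to $x$.
   Context: Log schemes have Zariski log structures. $x'\rightsquigarrow x$ means $x\in\overline{\{x'\}}$. All monoids are commutative; $P^{\mathrm{gp}}$ is the group completion of $P$ and $P^*$ its subgroup of invertible elements; $P$ is integral if $P\to P^{\mathrm{gp}}$ is injective. A valuative monoid is an integral monoid $P$ such that for every $a\in P^{\mathrm{gp}}$ either $a\in P$ or $-a\in P$. A log ring $(A,M)$ is a commutative ring $A$ with a homomorphism of monoids $M\to (A,\times)$. A homomorphism of monoids $\phi\colon P\to Q$ is logarithmic if the induced map $\phi^{-1}(Q^* )\to Q^*$ is an isomorphism. A log valuation ring is a log ring $(V,P)$ such that $V$ is a valuation ring, $P$ is a valuative monoid, and $P\to V$ is logarithmic. $\operatorname{Spec}(A,M)$ is the log scheme with underlying scheme $\operatorname{Spec} A$ and log structure associated with the prelog structure $M\to\mathcal{O}_{\operatorname{Spec} A}$ induced by $M\to A$. *)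

(* Defs.v *)
From HB Require Import structures.
From mathcomp Require Import all_boot all_order all_algebra.
From mathcomp Require Import ring generic_quotient fraction.
From mathcomp Require Import all_classical topology.

Set Implicit Arguments.
Unset Strict Implicit.
Unset Printing Implicit Defensive.
Import GRing.Theory.
Local Open Scope classical_set_scope.
Local Open Scope quotient_scope.
Local Open Scope ring_scope.

Section PropQuotient.
Variables (T : choiceType) (R : T -> T -> Prop).
Hypotheses (Rr : forall x, R x x) (Rs : forall x y, R x y -> R y x).
Hypothesis (Rt : forall x y z, R x y -> R y z -> R x z).

Let r : rel T := fun x y => `[< R x y >].
Fact prop_equiv_refl : reflexive r. Proof. by move=> x; apply/asboolP. Qed.
Fact prop_equiv_sym : symmetric r.
Proof. by move=> x y; apply/asbool_equiv_eq; split; exact: Rs. Qed.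
Fact prop_equiv_trans : transitive r.
Proof. by move=> y x z /asboolP xy /asboolP yz; apply/asboolP; exact: Rt xy yz. Qed.
Definition prop_equiv : equiv_rel T :=
  EquivRel r prop_equiv_refl prop_equiv_sym prop_equiv_trans.

Lemma prop_quotP (x y : T) :
  \pi_({eq_quot prop_equiv}) x = \pi_({eq_quot prop_equiv}) y <-> R x y.
Proof.
split=> [/eqquotP/asboolP //|h]; exact/eqquotP/asboolP.
Qed.
End PropQuotient.

(* Commutative monoids are [nmodType]s, written additively, and their
   homomorphisms are [{additive _ -> _}].  *)

Definition munit (Q : nmodType) (x : Q) : Prop := exists y, x + y = 0.

(* The multiplicative monoid of a commutative ring: here 0 is the one of [A]
   and + is its product. *)
Definition mulmon (A : Type) : Type := A.
HB.instance Definition _ (A : comPzRingType) := Choice.on (mulmon A).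
HB.instance Definition _ (A : comPzRingType) :=
  GRing.isNmodule.Build (mulmon A) (@mulrA A) (@mulrC A) (@mul1r A).

Definition mulmon_map (A B : comPzRingType) (f : {rmorphism A -> B}) :
  mulmon A -> mulmon B := f.
Fact mulmon_map_is_nmod_morphism (A B : comPzRingType) (f : {rmorphism A -> B}) :
  nmod_morphism (mulmon_map f).
Proof. by split; [exact: rmorph1 | exact: rmorphM]. Qed.
HB.instance Definition _ (A B : comPzRingType) (f : {rmorphism A -> B}) :=
  GRing.isNmodMorphism.Build (mulmon A) (mulmon B) (mulmon_map f)
    (mulmon_map_is_nmod_morphism f).

(* phi^-1(Q^x) -> Q^x is bijective, where Q^x is the group of units of Q. *)
Definition logarithmic (P Q : nmodType) (phi : {additive P -> Q}) : Prop :=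
  forall u : Q, munit u -> exists! p : P, phi p = u.

Section GroupCompletion.
Variable M : nmodType.
Definition gp_rel (x y : M * M) : Prop :=
  exists c, x.1 + y.2 + c = y.1 + x.2 + c.
Fact gp_rel_refl x : gp_rel x x. Proof. by exists 0. Qed.
Fact gp_rel_sym x y : gp_rel x y -> gp_rel y x.
Proof. by move=> [c e]; exists c. Qed.
Fact gp_rel_trans x y z : gp_rel x y -> gp_rel y z -> gp_rel x z.
Proof.
move: x y z => [a a'] [b b'] [c c'] [d /= e] [d' /= e'].
exists (b + b' + d + d') => /=.
rewrite [LHS](AC (2*4) ((1*4*5)*(3*2*6)))/= e e'.
by rewrite [LHS](AC (3*3) ((4*2)*(1*5*3*6))).
Qed.

Definition gp : Type := {eq_quot prop_equiv gp_rel_refl gp_rel_sym gp_rel_trans}.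
HB.instance Definition _ := Choice.on gp.
HB.instance Definition _ := Quotient.on gp.

Lemma gpP x y : \pi_gp x = \pi_gp y <-> gp_rel x y.
Proof. exact: prop_quotP. Qed.

Lemma gp_ind (K : gp -> Prop) : (forall x, K (\pi_gp x)) -> forall x, K x.
Proof. by move=> h x; rewrite -[x]reprK. Qed.

Definition gp_add (x y : gp) : gp :=
  \pi_gp ((repr x).1 + (repr y).1, (repr x).2 + (repr y).2).
Definition gp_opp (x : gp) : gp := \pi_gp ((repr x).2, (repr x).1).

Lemma gp_addE (x y : M * M) :
  gp_add (\pi_gp x) (\pi_gp y) = \pi_gp (x.1 + y.1, x.2 + y.2).
Proof.
apply/gpP.
have /gpP[c e] := reprK (\pi_gp x); have /gpP[d e'] := reprK (\pi_gp y).
exists (c + d) => /=.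
rewrite [LHS](AC ((2*2)*2) ((1*3*5)*(2*4*6)))/= e e'.
by rewrite [LHS](AC (3*3) (((1*4)*(2*5))*(3*6))).
Qed.

Lemma gp_oppE (x : M * M) : gp_opp (\pi_gp x) = \pi_gp (x.2, x.1).
Proof.
apply/gpP; have /gpP[c e] := reprK (\pi_gp x); exists c => /=.
by rewrite [(repr _).2 + _]addrC -e [x.2 + _]addrC.
Qed.

Fact gp_addA : associative gp_add.
Proof.
by elim/gp_ind=> x; elim/gp_ind=> y; elim/gp_ind=> z; rewrite !gp_addE /= !addrA.
Qed.
Fact gp_addC : commutative gp_add.
Proof.
elim/gp_ind=> x; elim/gp_ind=> y; rewrite !gp_addE.
by congr \pi_gp; congr pair; rewrite addrC.
Qed.
Fact gp_add0 : left_id (\pi_gp (0, 0)) gp_add.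
Proof. by elim/gp_ind=> -[x y]; rewrite gp_addE /= !add0r. Qed.
Fact gp_addN : left_inverse (\pi_gp (0, 0)) gp_opp gp_add.
Proof.
elim/gp_ind=> x; rewrite gp_oppE gp_addE; apply/gpP; exists 0 => /=.
by rewrite !addr0 add0r addrC.
Qed.
HB.instance Definition _ := GRing.isZmodule.Build gp gp_addA gp_addC gp_add0 gp_addN.

Definition to_gp (a : M) : gp := \pi_gp (a, 0).
Fact to_gp_is_nmod_morphism : nmod_morphism to_gp.
Proof. by split=> // x y; rewrite /to_gp [RHS]gp_addE /= addr0. Qed.
HB.instance Definition _ :=
  GRing.isNmodMorphism.Build M gp to_gp to_gp_is_nmod_morphism.
End GroupCompletion.

Definition integral_monoid (P : nmodType) : Prop := injective (@to_gp P).

Definition valuative_monoid (P : nmodType) : Prop :=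
  integral_monoid P /\
  forall a : gp P, (exists p, to_gp p = a) \/ (exists p, to_gp p = - a).

(* Fields are valuation rings. *)
Definition valuation_ring (V : idomainType) : Prop :=
  forall z : {fraction V}, z != 0 ->
    (exists a : V, z = tofrac a) \/ (exists a : V, z^-1 = tofrac a).

Definition log_valuation_ring (V : idomainType) (P : nmodType)
    (phi : {additive P -> mulmon V}) : Prop :=
  [/\ valuation_ring V, valuative_monoid P & logarithmic phi].

(* The pushout of P <- phi^-1(Q^x) -> Q^x in commutative monoids.  Since Q^x is
   a group, it is the quotient of P x Q^x by [log_rel]. *)
Section Pushout.
Variables (P Q : nmodType) (phi : {additive P -> Q}).

Record log_pair := LogPair { lp_mon : P; lp_unit : Q; lp_unitP : munit lp_unit }.
HB.instance Definition _ := gen_eqMixin log_pair.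
HB.instance Definition _ := gen_choiceMixin log_pair.

Definition log_rel (x y : log_pair) : Prop :=
  exists q q', [/\ munit (phi q), munit (phi q'),
    lp_mon x + q = lp_mon y + q' & lp_unit x + phi q' = lp_unit y + phi q].

Lemma munit0 (S : nmodType) : munit (0 : S). Proof. by exists 0; rewrite addr0. Qed.
Lemma munitD (S : nmodType) (x y : S) : munit x -> munit y -> munit (x + y).
Proof. by move=> [x' e] [y' e']; exists (x' + y'); rewrite addrACA e e' addr0. Qed.
Lemma munitDl (S : nmodType) (x y : S) : munit (x + y) -> munit x.
Proof. by move=> [z e]; exists (y + z); rewrite addrA. Qed.
Lemma munitI (S : nmodType) (u x y : S) : munit u -> x + u = y + u -> x = y.
Proof. by move=> [v e] /(congr1 (+%R^~ v)); rewrite -!addrA e !addr0. Qed.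
Lemma munit_add (S T : nmodType) (f : {additive S -> T}) x : munit x -> munit (f x).
Proof. by move=> [y e]; exists (f y); rewrite -raddfD e raddf0. Qed.

Fact log_rel_refl x : log_rel x x.
Proof. by exists 0, 0; split=> //; rewrite raddf0; exact: munit0. Qed.
Fact log_rel_sym x y : log_rel x y -> log_rel y x.
Proof. by move=> [q [q' [*]]]; exists q', q; split. Qed.
Fact log_rel_trans x y z : log_rel x y -> log_rel y z -> log_rel x z.
Proof.
move=> [q [q' [uq uq' e f]]] [r [r' [ur ur' e' f']]].
exists (q + r), (q' + r'); rewrite !raddfD; split.
- exact: munitD.
- exact: munitD.
- by rewrite addrA e addrAC e' addrAC addrA.
- by rewrite addrA f addrAC f' addrAC addrA.
Qed.

Definition logification : Type :=
  {eq_quot prop_equiv log_rel_refl log_rel_sym log_rel_trans}.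
HB.instance Definition _ := Choice.on logification.
HB.instance Definition _ := Quotient.on logification.

Lemma logP x y : \pi_logification x = \pi_logification y <-> log_rel x y.
Proof. exact: prop_quotP. Qed.
Lemma log_ind (K : logification -> Prop) : (forall x, K (\pi_logification x)) -> forall x, K x.
Proof. by move=> h x; rewrite -[x]reprK. Qed.

Definition lp_add x y : log_pair :=
  LogPair (lp_mon x + lp_mon y) (munitD (lp_unitP x) (lp_unitP y)).
Definition lp_zero : log_pair := LogPair 0 (munit0 Q).
Lemma log_pair_eq x y : lp_mon x = lp_mon y -> lp_unit x = lp_unit y -> x = y.
Proof.
by case: x y => [x u hu] [y v hv] /= -> e; subst v; congr LogPair; exact: Prop_irrelevance.
Qed.

Definition log_add (x y : logification) : logification :=
  \pi_logification (lp_add (repr x) (repr y)).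
Lemma log_addE (x y : log_pair) : log_add (\pi_logification x) (\pi_logification y) = \pi_logification (lp_add x y).
Proof.
apply/logP; have /logP := reprK (\pi_logification x).
have /logP := reprK (\pi_logification y).
move=> [q [q' [uq uq' e f]]] [r [r' [ur ur' e' f']]].
exists (r + q), (r' + q'); rewrite !raddfD /=; split; do ?exact: munitD.
  by rewrite addrACA e e' addrACA.
by rewrite addrACA f f' addrACA.
Qed.
Fact log_addA : associative log_add.
Proof.
elim/log_ind=> x; elim/log_ind=> y; elim/log_ind=> z; rewrite !log_addE.
by congr \pi_logification; apply: log_pair_eq; rewrite /= addrA.
Qed.
Fact log_addC : commutative log_add.
Proof.
elim/log_ind=> x; elim/log_ind=> y; rewrite !log_addE.
by congr \pi_logification; apply: log_pair_eq; rewrite /= addrC.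
Qed.
Fact log_add0 : left_id (\pi_logification lp_zero) log_add.
Proof.
elim/log_ind=> x; rewrite log_addE.
by congr \pi_logification; apply: log_pair_eq; rewrite /= add0r.
Qed.
HB.instance Definition _ :=
  GRing.isNmodule.Build logification log_addA log_addC log_add0.

Definition lp_val (x : log_pair) : Q := phi (lp_mon x) + lp_unit x.
Definition log_map (x : logification) : Q := lp_val (repr x).
Lemma log_mapE x : log_map (\pi_logification x) = lp_val x.
Proof.
have /logP[q [q' [uq uq' e f]]] := reprK (\pi_logification x).
apply: (munitI (munitD uq uq')); rewrite /log_map /lp_val.
by rewrite addrACA -raddfD e f raddfD addrACA [phi q' + _]addrC.
Qed.
Fact log_map_is_nmod_morphism : nmod_morphism log_map.
Proof.
split; first by rewrite [LHS]log_mapE /lp_val /= raddf0 addr0.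
elim/log_ind=> x; elim/log_ind=> y; rewrite [_ + _]log_addE !log_mapE.
by rewrite /lp_val /= raddfD addrACA.
Qed.
HB.instance Definition _ :=
  GRing.isNmodMorphism.Build logification Q log_map log_map_is_nmod_morphism.
End Pushout.

Section PushoutMap.
Variables (P Q P' Q' : nmodType) (phi : {additive P -> Q}) (phi' : {additive P' -> Q'}).
Variables (f : {additive P -> P'}) (g : {additive Q -> Q'}).
Hypothesis fg : forall p, phi' (f p) = g (phi p).

Definition lp_fun (x : log_pair P Q) : log_pair P' Q' :=
  LogPair (f (lp_mon x)) (munit_add g (lp_unitP x)).
Definition log_fun & (forall p, phi' (f p) = g (phi p)) :
  logification phi -> logification phi' := fun x => \pi_(logification phi') (lp_fun (repr x)).
Lemma log_funE x : log_fun fg (\pi_(logification phi) x) = \pi_(logification phi') (lp_fun x).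
Proof.
apply/logP; have /logP[q [q' [uq uq' e h]]] := reprK (\pi_(logification phi) x).
exists (f q), (f q'); rewrite !fg /= -!raddfD e h; split=> //; exact: munit_add.
Qed.
Fact log_fun_is_nmod_morphism : nmod_morphism (log_fun fg).
Proof.
split.
  by rewrite [LHS]log_funE; congr \pi_(logification phi'); apply: log_pair_eq; rewrite /= raddf0.
elim/log_ind=> x; elim/log_ind=> y.
rewrite [x in log_fun _ x]log_addE !log_funE [RHS]log_addE.
by congr \pi_(logification phi'); apply: log_pair_eq; rewrite /= raddfD.
Qed.
HB.instance Definition _ :=
  GRing.isNmodMorphism.Build (logification phi) (logification phi') (log_fun fg)
    log_fun_is_nmod_morphism.
End PushoutMap.

Record opens (X : topologicalType) := Opens { oset :> set X; opens_open : open oset }.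

(* Makes [U x] legible for [U : opens X]. *)
Identity Coercion fun_of_set : set >-> Funclass.

Definition opensI (X : topologicalType) (U V : opens X) : opens X :=
  Opens (openI (opens_open U) (opens_open V)).
Lemma opensIl (X : topologicalType) (U V : opens X) : opensI U V `<=` U.
Proof. exact: subIsetl. Qed.
Lemma opensIr (X : topologicalType) (U V : opens X) : opensI U V `<=` V.
Proof. exact: subIsetr. Qed.
Definition opensT (X : topologicalType) : opens X := Opens (@openT X).
Lemma opensTS (X : topologicalType) (U : opens X) : U `<=` opensT X.
Proof. by []. Qed.

Definition sheaf_axiom (X : topologicalType) (F : opens X -> Type)
    (res : forall U V : opens X, V `<=` U -> F U -> F V) : Prop :=
  forall (U : opens X) (I : Type) (V : I -> opens X) (VU : forall i, V i `<=` U),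
    U `<=` \bigcup_i V i ->
  forall s : forall i, F (V i),
    (forall i j (W : opens X) (Wi : W `<=` V i) (Wj : W `<=` V j),
       res _ _ Wi (s i) = res _ _ Wj (s j)) ->
  exists! t : F U, forall i, res _ _ (VU i) t = s i.

Record mon_presheaf (X : topologicalType) := MonPresheaf {
  mon_sec :> opens X -> nmodType;
  mon_res : forall U V : opens X, V `<=` U -> {additive mon_sec U -> mon_sec V};
  mon_res_id : forall (U : opens X) (h : U `<=` U) s, mon_res h s = s;
  mon_res_comp : forall (U V W : opens X) (h : V `<=` U) (k : W `<=` V) (l : W `<=` U) s,
    mon_res k (mon_res h s) = mon_res l s }.

Record ring_presheaf (X : topologicalType) := RingPresheaf {
  ring_sec :> opens X -> comPzRingType;
  ring_res : forall U V : opens X, V `<=` U -> {rmorphism ring_sec U -> ring_sec V};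
  ring_res_id : forall (U : opens X) (h : U `<=` U) s, ring_res h s = s;
  ring_res_comp : forall (U V W : opens X) (h : V `<=` U) (k : W `<=` V) (l : W `<=` U) s,
    ring_res k (ring_res h s) = ring_res l s }.

Arguments mon_res {X m U V} h.
Arguments ring_res {X r U V} h.

Definition mon_is_sheaf (X : topologicalType) (F : mon_presheaf X) : Prop :=
  sheaf_axiom (fun U V h => @mon_res X F U V h).
Definition ring_is_sheaf (X : topologicalType) (F : ring_presheaf X) : Prop :=
  sheaf_axiom (fun U V h => @ring_res X F U V h).

Record mon_mor (X : topologicalType) (F G : mon_presheaf X) := MonMor {
  mon_mor_sec :> forall U : opens X, {additive F U -> G U};
  mon_mor_nat : forall (U V : opens X) (h : V `<=` U) s,
    mon_mor_sec V (mon_res h s) = mon_res h (mon_mor_sec U s) }.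

Section MulPresheaf.
Variables (X : topologicalType) (O : ring_presheaf X).
Fact mul_res_id (U : opens X) (h : U `<=` U) (s : mulmon (O U)) : mulmon_map (ring_res h) s = s.
Proof. exact: ring_res_id. Qed.
Fact mul_res_comp (U V W : opens X) (h : V `<=` U) (k : W `<=` V) (l : W `<=` U)
  (s : mulmon (O U)) :
  mulmon_map (@ring_res X O _ _ k) (mulmon_map (@ring_res X O _ _ h) s) =
  mulmon_map (@ring_res X O _ _ l) s.
Proof. exact: ring_res_comp. Qed.
Definition mul_presheaf : mon_presheaf X :=
  @MonPresheaf X (fun U => mulmon (O U) : nmodType)
    (fun U V h => mulmon_map (ring_res h) : {additive _ -> _})
    mul_res_id mul_res_comp.
End MulPresheaf.

Section Stalk.
Variables (X : topologicalType) (F : mon_presheaf X) (x : X).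

Record germ_rep := GermRep { gdom : opens X; gmem : gdom x; gsec : F gdom }.
HB.instance Definition _ := gen_eqMixin germ_rep.
HB.instance Definition _ := gen_choiceMixin germ_rep.

Definition germ_rel (g h : germ_rep) : Prop :=
  exists (W : opens X) (Wg : W `<=` gdom g) (Wh : W `<=` gdom h),
    W x /\ mon_res Wg (gsec g) = mon_res Wh (gsec h).
Fact germ_rel_refl g : germ_rel g g.
Proof. by exists (gdom g), (@subset_refl _ _), (@subset_refl _ _); split=> //; exact: gmem. Qed.
Fact germ_rel_sym g h : germ_rel g h -> germ_rel h g.
Proof. by move=> [W [Wg [Wh [Wx e]]]]; exists W, Wh, Wg. Qed.
Fact germ_rel_trans g h k : germ_rel g h -> germ_rel h k -> germ_rel g k.
Proof.
move=> [W [Wg [Wh [Wx e]]]] [W' [W'h [W'k [W'x e']]]].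
have l : opensI W W' `<=` W by move=> y [].
have r : opensI W W' `<=` W' by move=> y [].
exists (opensI W W'), (subset_trans l Wg), (subset_trans r W'k); split=> //.
rewrite -(mon_res_comp Wg l) e (mon_res_comp Wh l (subset_trans l Wh)).
by rewrite -(mon_res_comp W'k r) -e' (mon_res_comp W'h r (subset_trans l Wh)).
Qed.

Definition stalk : Type :=
  {eq_quot prop_equiv germ_rel_refl germ_rel_sym germ_rel_trans}.
HB.instance Definition _ := Choice.on stalk.
HB.instance Definition _ := Quotient.on stalk.

Definition germ (U : opens X) (Ux : U x) (s : F U) : stalk := \pi_stalk (GermRep Ux s).

Lemma germP (U V : opens X) (Ux : U x) (Vx : V x) s t :
  germ Ux s = germ Vx t <->
  exists (W : opens X) (WU : W `<=` U) (WV : W `<=` V),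
    W x /\ mon_res WU s = mon_res WV t.
Proof. exact: prop_quotP. Qed.
Lemma stalk_ind (K : stalk -> Prop) :
  (forall (U : opens X) (Ux : U x) s, K (germ Ux s)) -> forall g, K g.
Proof. by move=> h g; rewrite -[g]reprK; case: (repr g) => U Ux s; exact: h. Qed.
Lemma germ_res (U V : opens X) (h : V `<=` U) (Ux : U x) (Vx : V x) s :
  germ Vx (mon_res h s) = germ Ux s.
Proof.
apply/germP; exists V, (@subset_refl _ _), h; split=> //.
by rewrite mon_res_id.
Qed.

Definition germ_add (U V : opens X) (Ux : U x) (Vx : V x) (s : F U) (t : F V) : stalk :=
  @germ (opensI U V) (conj Ux Vx)
    (mon_res (@opensIl _ _ _) s + mon_res (@opensIr _ _ _) t).
Definition stalk_add (g h : stalk) : stalk :=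
  germ_add (gmem (repr g)) (gmem (repr h)) (gsec (repr g)) (gsec (repr h)).

Lemma stalk_addE (U : opens X) (Ux : U x) (s t : F U) :
  stalk_add (germ Ux s) (germ Ux t) = germ Ux (s + t).
Proof.
have /prop_quotP[W [Wg [WU [Wx e]]]] := reprK (germ Ux s).
have /prop_quotP[W' [W'g [W'U [W'x e']]]] := reprK (germ Ux t).
rewrite /stalk_add /germ_add; apply/germP.
have l : opensI W W' `<=` W by move=> y [].
have r : opensI W W' `<=` W' by move=> y [].
have h : opensI W W' `<=` opensI (gdom (repr (germ Ux s))) (gdom (repr (germ Ux t))).
  by move=> y [Wy W'y]; split; [exact: (Wg y Wy) | exact: (W'g y W'y)].
exists (opensI W W'), h, (subset_trans l WU); split=> //.
rewrite !raddfD /= (mon_res_comp _ h (subset_trans l Wg)).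
rewrite (mon_res_comp _ h (subset_trans r W'g)).
rewrite -(mon_res_comp Wg l) e -(mon_res_comp W'g r) e' /=.
by rewrite (mon_res_comp _ _ (subset_trans l WU)) (mon_res_comp _ _ (subset_trans l WU)).
Qed.

Lemma stalk_ind2 (K : stalk -> stalk -> Prop) :
  (forall (U : opens X) (Ux : U x) s t, K (germ Ux s) (germ Ux t)) -> forall g h, K g h.
Proof.
move=> H; elim/stalk_ind=> U Ux s; elim/stalk_ind=> V Vx t.
rewrite -(@germ_res U (opensI U V) (@opensIl _ _ _) Ux (conj Ux Vx)).
by rewrite -(@germ_res V (opensI U V) (@opensIr _ _ _) Vx (conj Ux Vx)); exact: H.
Qed.
Lemma stalk_ind3 (K : stalk -> stalk -> stalk -> Prop) :
  (forall (U : opens X) (Ux : U x) s t u, K (germ Ux s) (germ Ux t) (germ Ux u)) ->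
  forall g h k, K g h k.
Proof.
move=> H g h k; move: g h; refine (stalk_ind2 _) => U Ux s t.
elim/stalk_ind: k => V Vx u.
have e w : germ Ux w = @germ (opensI U V) (conj Ux Vx) (mon_res (@opensIl _ _ _) w).
  by rewrite germ_res.
by rewrite !e -(@germ_res V (opensI U V) (@opensIr _ _ _) Vx (conj Ux Vx)); exact: H.
Qed.

Definition stalk0 : stalk := @germ (opensT X) I 0.
Lemma stalk0E (U : opens X) (Ux : U x) : germ Ux 0 = stalk0.
Proof. by rewrite /stalk0 -(germ_res (@opensTS X U) I Ux) raddf0. Qed.

Fact stalk_addA : associative stalk_add.
Proof. refine (stalk_ind3 _) => U Ux s t u; by rewrite !stalk_addE addrA. Qed.
Fact stalk_addC : commutative stalk_add.
Proof. refine (stalk_ind2 _) => U Ux s t; by rewrite !stalk_addE addrC. Qed.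
Fact stalk_add0 : left_id stalk0 stalk_add.
Proof. by elim/stalk_ind=> U Ux s; rewrite -(stalk0E Ux) stalk_addE add0r. Qed.
HB.instance Definition _ := GRing.isNmodule.Build stalk stalk_addA stalk_addC stalk_add0.

Fact germ_is_nmod_morphism (U : opens X) (Ux : U x) : nmod_morphism (germ Ux).
Proof. by split=> [|s t]; [exact: stalk0E | rewrite [RHS]stalk_addE]. Qed.
HB.instance Definition _ (U : opens X) (Ux : U x) :=
  GRing.isNmodMorphism.Build (F U) stalk (germ Ux) (germ_is_nmod_morphism Ux).
End Stalk.

Section StalkMap.
Variables (X : topologicalType) (F G : mon_presheaf X) (b : mon_mor F G) (x : X).
Definition stalk_map (g : stalk F x) : stalk G x :=
  germ (gmem (repr g)) (b _ (gsec (repr g))).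
Lemma stalk_mapE (U : opens X) (Ux : U x) s : stalk_map (germ Ux s) = germ Ux (b U s).
Proof.
have /prop_quotP[W [Wg [WU [Wx e]]]] := reprK (germ Ux s).
apply/germP; exists W, Wg, WU; split=> //.
by rewrite -!mon_mor_nat e.
Qed.
Lemma stalk_mapD g h : stalk_map (g + h) = stalk_map g + stalk_map h.
Proof.
move: g h; refine (stalk_ind2 _) => U Ux s t; by rewrite -raddfD !stalk_mapE -raddfD -raddfD.
Qed.
Lemma stalk_map0 : stalk_map 0 = 0.
Proof. by rewrite [LHS]stalk_mapE !raddf0. Qed.
End StalkMap.

(* Families (s x : S x)_{x in U} which near each point of U have the property L. *)
Section LocalSections.
Variables (X : topologicalType) (S : X -> Type).
Variable L : forall W : opens X, (forall x, W x -> S x) -> Prop.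
Arguments L : clear implicits.

Record lsec (U : opens X) := LSec {
  lfun : forall x, U x -> S x;
  lfunP : forall x, U x -> exists (W : opens X) (WU : W `<=` U),
    W x /\ L W (fun y Wy => lfun (WU y Wy)) }.
HB.instance Definition _ U := gen_eqMixin (lsec U).
HB.instance Definition _ U := gen_choiceMixin (lsec U).

Lemma lsec_ext (U : opens X) (s t : lsec U) :
  (forall x (Ux : U x), lfun s Ux = lfun t Ux) -> s = t.
Proof.
case: s t => [s hs] [t ht] /= e.
have {}e : s = t.
  by apply: functional_extensionality_dep => x; apply: functional_extensionality_dep.
by subst t; congr LSec; exact: Prop_irrelevance.
Qed.

Definition local_property : Prop := forall (W W' : opens X) (h : W' `<=` W) t,
  L W t -> L W' (fun y W'y => t y (h y W'y)).
Hypothesis Lres : local_property.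

Fact lsec_res_subproof (U V : opens X) (h : V `<=` U) (s : lsec U) x : V x ->
  exists (W : opens X) (WV : W `<=` V), W x /\ L W (fun y Wy => lfun s (h y (WV y Wy))).
Proof.
move=> Vx; have [W [WU [Wx Lt]]] := lfunP s (h x Vx).
exists (opensI W V), (@opensIr _ _ _); split=> //.
have := Lres (@opensIl _ W V) Lt.
by congr L; apply: functional_extensionality_dep => y;
  apply: functional_extensionality_dep => Wy; congr lfun; exact: Prop_irrelevance.
Qed.
Definition lsec_res (U V : opens X) (h : V `<=` U) (s : lsec U) : lsec V :=
  @LSec V (fun x Vx => lfun s (h x Vx)) (@lsec_res_subproof U V h s).

Lemma lfun_irr (U : opens X) (s : lsec U) x (h k : U x) : lfun s h = lfun s k.
Proof. by congr lfun; exact: Prop_irrelevance. Qed.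

Lemma lsec_sheaf : sheaf_axiom lsec_res.
Proof.
move=> U I V VU cov s comp.
have ex x (Ux : U x) : exists i, V i x by have [i _ Vx] := cov x Ux; exists i.
pose i x Ux := projT1 (cid (ex x Ux)).
have iP x Ux : V (i x Ux) x := projT2 (cid (ex x Ux)).
pose f x Ux := lfun (s (i x Ux)) (iP x Ux).
have fE j x (Ux : U x) (Vx : V j x) : f x Ux = lfun (s j) Vx.
  have := comp (i x Ux) j (opensI (V (i x Ux)) (V j)) (@opensIl _ _ _) (@opensIr _ _ _).
  move=> /(congr1 (fun w => lfun w (conj (iP x Ux) Vx : opensI (V (i x Ux)) (V j) x))) /=.
  by rewrite /f (lfun_irr _ _ (iP x Ux)) => ->; exact: lfun_irr.
have fP x : U x -> exists (W : opens X) (WU : W `<=` U),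
    W x /\ L W (fun y Wy => f y (WU y Wy)).
  move=> Ux; have [j _ Vx] := cov x Ux.
  have [W [WV [Wx Lt]]] := lfunP (s j) Vx.
  exists W, (subset_trans WV (VU j)); split=> //.
  move: Lt; congr L; apply: functional_extensionality_dep => y.
  by apply: functional_extensionality_dep => Wy; rewrite (fE j _ _ (WV y Wy)).
exists (LSec fP); split=> [j|t tP].
  by apply: lsec_ext => x Vx; exact: fE.
apply: lsec_ext => x Ux; rewrite /= /f -tP /=; exact: lfun_irr.
Qed.

Section Ops.
Variables (o0 : forall x, S x) (o1 : forall x, S x -> S x) (o2 : forall x, S x -> S x -> S x).
Hypothesis L0 : forall W, L W (fun x _ => o0 x).
Hypothesis L1 : forall W t, L W t -> L W (fun x Wx => o1 (t x Wx)).
Hypothesis L2 : forall W t u, L W t -> L W u -> L W (fun x Wx => o2 (t x Wx) (u x Wx)).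

Fact lsec0_subproof (U : opens X) x (Ux : U x) : exists (W : opens X) (WU : W `<=` U),
  W x /\ L W (fun y _ => o0 y).
Proof. by exists U, (@subset_refl _ _). Qed.
Definition lsec0 (U : opens X) : lsec U := @LSec U (fun x _ => o0 x) (@lsec0_subproof U).

Fact lsec1_subproof (U : opens X) (s : lsec U) x (Ux : U x) :
  exists (W : opens X) (WU : W `<=` U),
  W x /\ L W (fun y Wy => o1 (lfun s (WU y Wy))).
Proof.
have [W [WU [Wx Ls]]] := lfunP s Ux.
by exists W, WU; split=> //; exact: (L1 Ls).
Qed.
Definition lsec1 (U : opens X) (s : lsec U) : lsec U := @LSec U (fun x Ux => o1 (lfun s Ux)) (@lsec1_subproof U s).

Fact lsec2_subproof (U : opens X) (s t : lsec U) x (Ux : U x) :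
  exists (W : opens X) (WU : W `<=` U),
  W x /\ L W (fun y Wy => o2 (lfun s (WU y Wy)) (lfun t (WU y Wy))).
Proof.
have [W [WU [Wx Ls]]] := lfunP s Ux; have [W' [W'U [W'x Lt]]] := lfunP t Ux.
exists (opensI W W'), (subset_trans (@opensIl _ _ _) WU); split=> //.
have := L2 (Lres (@opensIl _ W W') Ls)
           (Lres (@opensIr _ W W') Lt).
congr L; apply: functional_extensionality_dep => y.
by apply: functional_extensionality_dep => Wy; congr o2; exact: lfun_irr.
Qed.
Definition lsec2 (U : opens X) (s t : lsec U) : lsec U := @LSec U (fun x Ux => o2 (lfun s Ux) (lfun t Ux)) (@lsec2_subproof U s t).
End Ops.
End LocalSections.

Section Sheafification.
Variables (X : topologicalType) (G : mon_presheaf X).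

Definition is_germs (W : opens X) (t : forall x, W x -> stalk G x) : Prop :=
  exists g : G W, forall x (Wx : W x), t x Wx = germ Wx g.
Fact is_germs_local : local_property is_germs.
Proof.
move=> W W' h t [g tE]; exists (mon_res h g) => x W'x.
by rewrite (germ_res h (h x W'x)) tE.
Qed.

Definition sheafify_sec (U : opens X) : Type := lsec is_germs U.
HB.instance Definition _ U := Choice.on (sheafify_sec U).

Fact is_germs0 (W : opens X) : @is_germs W (fun x _ => 0).
Proof. by exists 0 => x Wx; rewrite raddf0. Qed.
Fact is_germsD (W : opens X) t u : @is_germs W t -> @is_germs W u ->
  @is_germs W (fun x Wx => t x Wx + u x Wx).
Proof. by move=> [g tE] [h uE]; exists (g + h) => x Wx; rewrite tE uE raddfD. Qed.

Definition sheafify_zero (U : opens X) : sheafify_sec U := lsec0 is_germs0 U.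
Definition sheafify_add (U : opens X) (s t : sheafify_sec U) : sheafify_sec U :=
  lsec2 is_germs_local is_germsD s t.
Fact sheafify_addA U : associative (@sheafify_add U).
Proof. by move=> s t u; apply: lsec_ext => x Ux; exact: addrA. Qed.
Fact sheafify_addC U : commutative (@sheafify_add U).
Proof. by move=> s t; apply: lsec_ext => x Ux; exact: addrC. Qed.
Fact sheafify_add0 U : left_id (sheafify_zero U) (@sheafify_add U).
Proof. by move=> s; apply: lsec_ext => x Ux; exact: add0r. Qed.
HB.instance Definition _ U := GRing.isNmodule.Build (sheafify_sec U)
  (@sheafify_addA U) (@sheafify_addC U) (@sheafify_add0 U).

Definition sheafify_res (U V : opens X) (h : V `<=` U) :
  sheafify_sec U -> sheafify_sec V := lsec_res is_germs_local h.
Fact sheafify_res_is_nmod_morphism (U V : opens X) (h : V `<=` U) :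
  nmod_morphism (sheafify_res h).
Proof. by split=> [|s t]; apply: lsec_ext. Qed.
HB.instance Definition _ (U V : opens X) (h : V `<=` U) :=
  GRing.isNmodMorphism.Build (sheafify_sec U) (sheafify_sec V) (sheafify_res h)
    (sheafify_res_is_nmod_morphism h).

Fact sheafify_res_id (U : opens X) (h : U `<=` U) s : sheafify_res h s = s.
Proof. by apply: lsec_ext => x Ux; exact: (lfun_irr s). Qed.
Fact sheafify_res_comp (U V W : opens X) (h : V `<=` U) (k : W `<=` V) (l : W `<=` U) s :
  sheafify_res k (sheafify_res h s) = sheafify_res l s.
Proof. by apply: lsec_ext => x Ux; exact: (lfun_irr s). Qed.
Definition sheafify : mon_presheaf X :=
  @MonPresheaf X (fun U => sheafify_sec U : nmodType)
    (fun U V h => sheafify_res h : {additive _ -> _})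
    sheafify_res_id sheafify_res_comp.
Lemma sheafify_is_sheaf : mon_is_sheaf sheafify.
Proof. exact: lsec_sheaf. Qed.
End Sheafification.

(* The morphism from the sheafification of G to a sheaf H induced by b : G -> H. *)
Section SheafifyDesc.
Variables (X : topologicalType) (G H : mon_presheaf X) (b : mon_mor G H).
Hypothesis Hsh : mon_is_sheaf H.

Lemma sheaf_sep (U : opens X) (s t : H U) :
  (forall x (Ux : U x), germ Ux s = germ Ux t) -> s = t.
Proof.
move=> e.
have ex (i : {x | U x}) : exists W : opens X, W (sval i) /\
    exists WU : W `<=` U, mon_res WU s = mon_res WU t.
  case: i => x Ux /=; have /germP[W [WU [WV [Wx eW]]]] := e x Ux.
  by exists W; split=> //; exists WU; rewrite eW; congr (mon_res _ t); exact: Prop_irrelevance.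
have [V VP] := choice ex.
have VU i : V i `<=` U by have [_ []] := VP i.
have := @Hsh U _ V VU _ (fun i => mon_res (VU i) s).
case.
- by move=> x Ux; exists (exist _ x Ux) => //; have [] := VP (exist _ x Ux).
- move=> i j W Wi Wj.
  by rewrite (mon_res_comp _ _ (subset_trans Wi (VU i))) (mon_res_comp _ _ (subset_trans Wi (VU i))).
move=> u [_ uP]; rewrite -(uP s) //; apply: uP => i.
have [_ [h eh]] := VP i.
by rewrite (Prop_irrelevance (VU i) h).
Qed.

Lemma sheafify_desc_ex (U : opens X) (s : sheafify_sec G U) :
  exists t : H U, forall x (Ux : U x), germ Ux t = stalk_map b (lfun s Ux).
Proof.
have ex (i : {x | U x}) : exists W : opens X, W (sval i) /\
    exists (WU : W `<=` U) (t : H W),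
      forall y (Wy : W y), germ Wy t = stalk_map b (lfun s (WU y Wy)).
  case: i => x Ux /=; have [W [WU [Wx [g gE]]]] := lfunP s Ux.
  exists W; split=> //; exists WU, (b W g) => y Wy.
  by rewrite gE stalk_mapE.
have [V VP] := choice ex.
have VU i : V i `<=` U by have [_ []] := VP i.
have VP0 := VP.
have {}VP i : exists t : H (V i), forall y (Wy : V i y),
    germ Wy t = stalk_map b (lfun s (VU i y Wy)).
  have [_ [h [t tP]]] := VP i; exists t => y Wy.
  by rewrite tP; congr stalk_map; exact: lfun_irr.
pose t i := projT1 (cid (VP i)).
have tP i (y : X) (Vy : V i y) : germ Vy (t i) = stalk_map b (lfun s (VU i y Vy)).
  exact: (projT2 (cid (VP i))).
have cov : U `<=` \bigcup_i V i.
  by move=> x Ux; exists (exist _ x Ux) => //; have [] := VP0 (exist _ x Ux).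
have [|u [uP _]] := Hsh VU cov (s := t).
  move=> i j W Wi Wj; apply: sheaf_sep => x Wx.
  rewrite (germ_res Wi (Wi x Wx)) (germ_res Wj (Wj x Wx)) !tP.
  by congr stalk_map; exact: lfun_irr.
exists u => x Ux; have [i _ Vx] := cov x Ux.
by rewrite -(germ_res (VU i) Ux Vx) uP tP; congr stalk_map; exact: lfun_irr.
Qed.

Definition sheafify_desc_fun (U : opens X) (s : sheafify_sec G U) : H U :=
  projT1 (cid (sheafify_desc_ex s)).
Lemma sheafify_descP (U : opens X) (s : sheafify_sec G U) x (Ux : U x) :
  germ Ux (sheafify_desc_fun s) = stalk_map b (lfun s Ux).
Proof. exact: (projT2 (cid (sheafify_desc_ex s))). Qed.

Fact sheafify_desc_is_nmod_morphism (U : opens X) :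
  nmod_morphism (sheafify_desc_fun (U := U)).
Proof.
split=> [|s t]; apply: sheaf_sep => x Ux.
  by rewrite sheafify_descP [RHS]raddf0 -[RHS](stalk_map0 b x).
have -> : germ Ux (sheafify_desc_fun s + sheafify_desc_fun t) =
    germ Ux (sheafify_desc_fun s) + germ Ux (sheafify_desc_fun t) by rewrite raddfD.
by rewrite !sheafify_descP -stalk_mapD.
Qed.
HB.instance Definition _ (U : opens X) :=
  GRing.isNmodMorphism.Build (sheafify_sec G U) (H U) (sheafify_desc_fun (U := U))
    (sheafify_desc_is_nmod_morphism U).
Fact sheafify_desc_nat (U V : opens X) (h : V `<=` U) (s : sheafify_sec G U) :
  sheafify_desc_fun (sheafify_res h s) = mon_res h (sheafify_desc_fun s).
Proof.
apply: sheaf_sep => x Vx; rewrite sheafify_descP (germ_res h (h x Vx)) sheafify_descP.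
by [].
Qed.
Definition sheafify_desc : mon_mor (sheafify G) H :=
  @MonMor X (sheafify G) H
    (fun U => sheafify_desc_fun (U := U) : {additive _ -> _}) sheafify_desc_nat.
End SheafifyDesc.

(* The presheaf sending U to the pushout of N(U) <- a^-1(G(U)^x) -> G(U)^x. *)
Section LogPresheaf.
Variables (X : topologicalType) (N G : mon_presheaf X) (a : mon_mor N G).

Definition log_res (U V : opens X) (h : V `<=` U) :
  {additive logification (a U) -> logification (a V)} :=
  log_fun (f := mon_res h) (g := mon_res h) (mon_mor_nat a h).
Lemma log_resE (U V : opens X) (h : V `<=` U) x :
  log_res h (\pi_(logification (a U)) x) =
  \pi_(logification (a V)) (lp_fun (mon_res h) (mon_res h) x).
Proof. exact: log_funE. Qed.
Fact log_res_id (U : opens X) (h : U `<=` U) x : log_res h x = x.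
Proof.
elim/log_ind: x => x; rewrite log_resE; congr \pi_(logification (a U)).
by apply: log_pair_eq; rewrite /= mon_res_id.
Qed.
Fact log_res_comp (U V W : opens X) (h : V `<=` U) (k : W `<=` V) (l : W `<=` U) x :
  log_res k (log_res h x) = log_res l x.
Proof.
elim/log_ind: x => x; rewrite !log_resE; congr \pi_(logification (a W)).
by apply: log_pair_eq; rewrite /= (mon_res_comp h k l).
Qed.
Definition log_presheaf : mon_presheaf X :=
  @MonPresheaf X (fun U => logification (a U) : nmodType) log_res log_res_id log_res_comp.

Fact log_presheaf_map_nat (U V : opens X) (h : V `<=` U) x :
  log_map (log_res h x) = mon_res h (log_map x).
Proof.
elim/log_ind: x => x; rewrite log_resE !log_mapE /lp_val /= raddfD.
by rewrite mon_mor_nat.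
Qed.
Definition log_presheaf_map : mon_mor log_presheaf G :=
  @MonMor X log_presheaf G (fun U => log_map (phi := a U) : {additive _ -> _})
    log_presheaf_map_nat.
End LogPresheaf.

Lemma assoc_logarithmic (X : topologicalType) (N G : mon_presheaf X) (a : mon_mor N G)
  (Gsh : mon_is_sheaf G) (U : opens X) :
  logarithmic (sheafify_desc (log_presheaf_map a) Gsh U).
Proof.
set d := sheafify_desc _ _.
move=> u uu.
have sP x (Ux : U x) : exists (W : opens X) (WU : W `<=` U), W x /\
   is_germs (W := W) (fun y Wy => germ (F := log_presheaf a) (WU y Wy)
     (\pi_(logification (a U)) (LogPair 0 uu))).
  exists U, (@subset_refl _ _); split=> //.
  exists (\pi_(logification (a U)) (LogPair 0 uu)) => y Wy.
  by congr germ; exact: Prop_irrelevance.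
pose s0 : sheafify_sec (log_presheaf a) U :=
  @LSec _ _ _ U (fun x Ux => germ (F := log_presheaf a) Ux
    (\pi_(logification (a U)) (LogPair 0 uu))) sP.
exists s0; split.
  apply: (sheaf_sep Gsh) => x Ux; rewrite sheafify_descP /= stalk_mapE /=.
  by rewrite log_mapE /lp_val /= raddf0 add0r.
move=> s sE; apply: lsec_ext => x Ux /=.
have := sheafify_descP (log_presheaf_map a) Gsh s Ux.
have -> : sheafify_desc_fun (log_presheaf_map a) Gsh s = u by exact: sE.
elim/stalk_ind: (lfun s Ux) => W Wx t; elim/log_ind: t => -[n v vu].
rewrite stalk_mapE /= log_mapE /lp_val /= => /germP[W' [W'U [W'W [W'x e]]]].
apply/germP; exists W', W'U, W'W; split=> //=.
rewrite !log_resE; apply/logP.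
have e' : a W' (mon_res W'W n) + mon_res W'W v = mon_res W'U u.
  by rewrite e raddfD mon_mor_nat.
exists (mon_res W'W n), 0; split=> /=.
- by apply: (@munitDl _ _ (mon_res W'W v)); rewrite e'; exact: munit_add.
- by rewrite raddf0; exact: munit0.
- by rewrite raddf0 add0r addr0.
- by rewrite raddf0 addr0 [RHS]addrC e'.
Qed.

Definition prime_ideal (A : comPzRingType) (I : set A) : Prop :=
  [/\ I 0, forall x y, I x -> I y -> I (x + y), forall a x, I x -> I (a * x),
      ~ I 1 & forall x y, I (x * y) -> I x \/ I y].

Record spec_pt (A : comPzRingType) := SpecPt {
  pt_ideal :> set A; pt_prime : prime_ideal pt_ideal }.
HB.instance Definition _ A := gen_eqMixin (spec_pt A).
HB.instance Definition _ A := gen_choiceMixin (spec_pt A).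

Lemma spec_pt_eq (A : comPzRingType) (p q : spec_pt A) :
  (forall a : A, p a <-> q a) -> p = q.
Proof.
case: p q => [p hp] [q hq] /= e; have {}e : p = q by apply/seteqP; split=> a /e.
by subst q; congr SpecPt; exact: Prop_irrelevance.
Qed.

Section ZariskiTopology.
Variable A : comPzRingType.

(* The complements of the sets V(E) = { p | E `<=` p } *)
Definition zariski_open (U : set (spec_pt A)) : Prop :=
  exists E : set A, forall p, U p <-> ~ (E `<=` p).

Fact zariski_openT : zariski_open setT.
Proof. by exists setT => p; split=> // _ h; have [_ _ _ + _] := pt_prime p; apply; exact: h. Qed.
Fact zariski_openI : setI_closed zariski_open.
Proof.
move=> U V [E UE] [F VF].
exists [set x | exists a b, [/\ E a, F b & x = a * b]] => p; split.
  move=> [/UE nE /VF nF] h.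
  have [a Ea na] : exists2 a, E a & ~ p a.
    by apply: contrapT => H; apply: nE => a Ea; apply: contrapT => na; apply: H; exists a.
  have [b Fb nb] : exists2 b, F b & ~ p b.
    by apply: contrapT => H; apply: nF => b Fb; apply: contrapT => nb; apply: H; exists b.
  have [_ _ _ _ pr] := pt_prime p.
  by have [] := pr a b (h (a * b) (ex_intro _ a (ex_intro _ b (And3 Ea Fb erefl)))).
have [_ _ id _ _] := pt_prime p.
move=> h; split; [apply/UE|apply/VF] => H; apply: h => _ [a [b [Ea Fb ->]]].
- by rewrite mulrC; apply: id; exact: H.
- by apply: id; exact: H.
Qed.
Fact zariski_open_bigU (I : Type) (f : I -> set (spec_pt A)) :
  (forall i, zariski_open (f i)) -> zariski_open (\bigcup_i f i).
Proof.
move=> fE; exists [set a | exists i (E : set A), (forall p, f i p <-> ~ (E `<=` p)) /\ E a] => p.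
split.
  move=> [i _ fp] h; have [E EP] := fE i.
  by apply: (EP p).1 => // a Ea; apply: h; exists i, E.
move=> h; apply: contrapT => H; apply: h => a [i [E [EP Ea]]].
apply: contrapT => na; apply: H; exists i => //; apply/EP => h.
by apply: na; exact: h.
Qed.
HB.instance Definition _ := isOpenTopological.Build (spec_pt A)
  zariski_openT zariski_openI zariski_open_bigU.
End ZariskiTopology.

Section Localization.
Variables (A : comPzRingType) (p : spec_pt A).

Record loc_pair := LocPair { lnum : A; lden : A; ldenP : ~ p lden }.
HB.instance Definition _ := gen_eqMixin loc_pair.
HB.instance Definition _ := gen_choiceMixin loc_pair.

Definition loc_rel (x y : loc_pair) : Prop :=
  exists u, ~ p u /\ u * (lnum x * lden y) = u * (lnum y * lden x).

Lemma notin1 : ~ p 1. Proof. by have [_ _ _ n _] := pt_prime p. Qed.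
Lemma notinM a b : ~ p a -> ~ p b -> ~ p (a * b).
Proof. by have [_ _ _ _ h] := pt_prime p => na nb /h[]. Qed.

Fact loc_rel_refl x : loc_rel x x.
Proof. by exists 1; split=> //; exact: notin1. Qed.
Fact loc_rel_sym x y : loc_rel x y -> loc_rel y x.
Proof. by move=> [u [nu e]]; exists u. Qed.
Fact loc_rel_trans x y z : loc_rel x y -> loc_rel y z -> loc_rel x z.
Proof.
move: x y z => [a s ns] [b t nt] [c r nr] [u [nu /= e]] [v [nv /= e']].
exists (u * v * t); split; first by apply: notinM => //; exact: notinM.
rewrite /=; transitivity (v * r * (u * (a * t))); first ring.
rewrite e; transitivity (u * s * (v * (b * r))); first ring.
by rewrite e'; ring.
Qed.

Definition loc : Type :=
  {eq_quot prop_equiv loc_rel_refl loc_rel_sym loc_rel_trans}.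
HB.instance Definition _ := Choice.on loc.
HB.instance Definition _ := Quotient.on loc.

Lemma locP x y : \pi_loc x = \pi_loc y <-> loc_rel x y.
Proof. exact: prop_quotP. Qed.
Lemma loc_ind (K : loc -> Prop) : (forall x, K (\pi_loc x)) -> forall x, K x.
Proof. by move=> h x; rewrite -[x]reprK. Qed.
Lemma loc_eq x y : lnum x * lden y = lnum y * lden x -> \pi_loc x = \pi_loc y.
Proof. by move=> e; apply/locP; exists 1; split; [exact: notin1 | rewrite e]. Qed.

Definition loc_frac (a b : A) (nb : ~ p b) : loc := \pi_loc (LocPair a nb).

Definition lpair_add x y : loc_pair :=
  LocPair (lnum x * lden y + lnum y * lden x) (notinM (@ldenP x) (@ldenP y)).
Definition lpair_mul x y : loc_pair :=
  LocPair (lnum x * lnum y) (notinM (@ldenP x) (@ldenP y)).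
Definition lpair_opp x : loc_pair := LocPair (- lnum x) (@ldenP x).

Definition loc_add (x y : loc) : loc := \pi_loc (lpair_add (repr x) (repr y)).
Definition loc_mul (x y : loc) : loc := \pi_loc (lpair_mul (repr x) (repr y)).
Definition loc_opp (x : loc) : loc := \pi_loc (lpair_opp (repr x)).

Lemma loc_addE x y : loc_add (\pi_loc x) (\pi_loc y) = \pi_loc (lpair_add x y).
Proof.
rewrite /loc_add.
have /locP := reprK (\pi_loc x); have /locP := reprK (\pi_loc y).
move: (repr (\pi_loc x)) (repr (\pi_loc y)) => r r'.
case: r r' x y => [a' s' ns'] [b' t' nt'] [a s ns] [b t nt].
move=> [v [nv /= e']] [u [nu /= e]].
apply/locP; exists (u * v); split; first exact: notinM.
rewrite /=; transitivity (v * t * t' * (u * (a' * s)) + u * s * s' * (v * (b' * t))); first ring.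
by rewrite e e'; ring.
Qed.
Lemma loc_mulE x y : loc_mul (\pi_loc x) (\pi_loc y) = \pi_loc (lpair_mul x y).
Proof.
rewrite /loc_mul.
have /locP := reprK (\pi_loc x); have /locP := reprK (\pi_loc y).
move: (repr (\pi_loc x)) (repr (\pi_loc y)) => r r'.
case: r r' x y => [a' s' ns'] [b' t' nt'] [a s ns] [b t nt].
move=> [v [nv /= e']] [u [nu /= e]].
apply/locP; exists (u * v); split; first exact: notinM.
rewrite /=; transitivity ((u * (a' * s)) * (v * (b' * t))); first ring.
by rewrite e e'; ring.
Qed.
Lemma loc_oppE x : loc_opp (\pi_loc x) = \pi_loc (lpair_opp x).
Proof.
rewrite /loc_opp; have /locP := reprK (\pi_loc x).
move: (repr (\pi_loc x)) => r; case: r x => [a' s' ns'] [a s ns] [u [nu /= e]].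
apply/locP; exists u; split=> //=; transitivity (- (u * (a' * s))); first ring.
by rewrite e; ring.
Qed.

Fact loc_addA : associative loc_add.
Proof.
elim/loc_ind=> x; elim/loc_ind=> y; elim/loc_ind=> z; rewrite !loc_addE.
by apply: loc_eq => /=; ring.
Qed.
Fact loc_addC : commutative loc_add.
Proof.
by elim/loc_ind=> x; elim/loc_ind=> y; rewrite !loc_addE; apply: loc_eq => /=; ring.
Qed.
Fact loc_add0 : left_id (loc_frac 0 notin1) loc_add.
Proof. by elim/loc_ind=> x; rewrite loc_addE; apply: loc_eq => /=; ring. Qed.
Fact loc_addN : left_inverse (loc_frac 0 notin1) loc_opp loc_add.
Proof. by elim/loc_ind=> x; rewrite loc_oppE loc_addE; apply: loc_eq => /=; ring. Qed.
HB.instance Definition _ := GRing.isZmodule.Build loc loc_addA loc_addC loc_add0 loc_addN.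

Fact loc_mulA : associative loc_mul.
Proof.
elim/loc_ind=> x; elim/loc_ind=> y; elim/loc_ind=> z; rewrite !loc_mulE.
by apply: loc_eq => /=; ring.
Qed.
Fact loc_mulC : commutative loc_mul.
Proof.
by elim/loc_ind=> x; elim/loc_ind=> y; rewrite !loc_mulE; apply: loc_eq => /=; ring.
Qed.
Fact loc_mul1 : left_id (loc_frac 1 notin1) loc_mul.
Proof. by elim/loc_ind=> x; rewrite loc_mulE; apply: loc_eq => /=; ring. Qed.
Fact loc_mulDl : left_distributive loc_mul loc_add.
Proof.
elim/loc_ind=> x; elim/loc_ind=> y; elim/loc_ind=> z.
by rewrite loc_addE !loc_mulE loc_addE; apply: loc_eq => /=; ring.
Qed.
HB.instance Definition _ :=
  GRing.Zmodule_isComPzRing.Build loc loc_mulA loc_mulC loc_mul1 loc_mulDl.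

Lemma loc_fracD a b c d (nb : ~ p b) (nd : ~ p d) :
  loc_frac a nb + loc_frac c nd = loc_frac (a * d + c * b) (notinM nb nd).
Proof. by rewrite [LHS]loc_addE; apply: loc_eq. Qed.
Lemma loc_fracM a b c d (nb : ~ p b) (nd : ~ p d) :
  loc_frac a nb * loc_frac c nd = loc_frac (a * c) (notinM nb nd).
Proof. by rewrite [LHS]loc_mulE; apply: loc_eq. Qed.
Lemma loc_fracN a b (nb : ~ p b) : - loc_frac a nb = loc_frac (- a) nb.
Proof. by rewrite [LHS]loc_oppE; apply: loc_eq. Qed.
End Localization.

Section StructureSheaf.
Variable A : comPzRingType.
Local Notation X := (spec_pt A : topologicalType).

Definition is_fraction (W : opens X) (t : forall p : X, W p -> loc p) : Prop :=
  exists a b : A, forall p (Wp : W p), exists nb : ~ p b, t p Wp = loc_frac a nb.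
Arguments is_fraction : clear implicits.

Fact is_fraction_local : local_property is_fraction.
Proof. by move=> W W' h t [a [b tE]]; exists a, b => p W'p; exact: tE. Qed.
Fact is_fraction0 W : is_fraction W (fun _ _ => 0).
Proof. by exists 0, 1 => p _; exists (@notin1 A p). Qed.
Fact is_fraction1 W : is_fraction W (fun _ _ => 1).
Proof. by exists 1, 1 => p _; exists (@notin1 A p). Qed.
Fact is_fractionN W t : is_fraction W t -> is_fraction W (fun p Wp => - t p Wp).
Proof.
move=> [a [b tE]]; exists (- a), b => p Wp; have [nb ->] := tE p Wp.
by exists nb; rewrite loc_fracN.
Qed.
Fact is_fractionD W t u : is_fraction W t -> is_fraction W u ->
  is_fraction W (fun p Wp => t p Wp + u p Wp).
Proof.
move=> [a [b tE]] [c [d uE]]; exists (a * d + c * b), (b * d) => p Wp.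
have [nb ->] := tE p Wp; have [nd ->] := uE p Wp.
by exists (notinM nb nd); rewrite loc_fracD.
Qed.
Fact is_fractionM W t u : is_fraction W t -> is_fraction W u ->
  is_fraction W (fun p Wp => t p Wp * u p Wp).
Proof.
move=> [a [b tE]] [c [d uE]]; exists (a * c), (b * d) => p Wp.
have [nb ->] := tE p Wp; have [nd ->] := uE p Wp.
by exists (notinM nb nd); rewrite loc_fracM.
Qed.

Definition spec_sec (U : opens X) : Type := lsec is_fraction U.
HB.instance Definition _ U := Choice.on (spec_sec U).

Definition spec_zero (U : opens X) : spec_sec U := lsec0 is_fraction0 U.
Definition spec_one (U : opens X) : spec_sec U := lsec0 is_fraction1 U.
Definition spec_opp (U : opens X) (s : spec_sec U) : spec_sec U := lsec1 is_fractionN s.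
Definition spec_add (U : opens X) (s t : spec_sec U) : spec_sec U :=
  lsec2 is_fraction_local is_fractionD s t.
Definition spec_mul (U : opens X) (s t : spec_sec U) : spec_sec U :=
  lsec2 is_fraction_local is_fractionM s t.

Fact spec_addA U : associative (@spec_add U).
Proof. by move=> s t u; apply: lsec_ext => p Up; exact: addrA. Qed.
Fact spec_addC U : commutative (@spec_add U).
Proof. by move=> s t; apply: lsec_ext => p Up; exact: addrC. Qed.
Fact spec_add0 U : left_id (spec_zero U) (@spec_add U).
Proof. by move=> s; apply: lsec_ext => p Up; exact: add0r. Qed.
Fact spec_addN U : left_inverse (spec_zero U) (@spec_opp U) (@spec_add U).
Proof. by move=> s; apply: lsec_ext => p Up; exact: addNr. Qed.
HB.instance Definition _ U := GRing.isZmodule.Build (spec_sec U)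
  (@spec_addA U) (@spec_addC U) (@spec_add0 U) (@spec_addN U).
Fact spec_mulA U : associative (@spec_mul U).
Proof. by move=> s t u; apply: lsec_ext => p Up; exact: mulrA. Qed.
Fact spec_mulC U : commutative (@spec_mul U).
Proof. by move=> s t; apply: lsec_ext => p Up; exact: mulrC. Qed.
Fact spec_mul1 U : left_id (spec_one U) (@spec_mul U).
Proof. by move=> s; apply: lsec_ext => p Up; exact: mul1r. Qed.
Fact spec_mulDl U : left_distributive (@spec_mul U) (@spec_add U).
Proof. by move=> s t u; apply: lsec_ext => p Up; exact: mulrDl. Qed.
HB.instance Definition _ U := GRing.Zmodule_isComPzRing.Build (spec_sec U)
  (@spec_mulA U) (@spec_mulC U) (@spec_mul1 U) (@spec_mulDl U).

Definition spec_res (U V : opens X) (h : V `<=` U) : spec_sec U -> spec_sec V :=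
  lsec_res is_fraction_local h.
Section Res.
Variables (U V : opens X) (h : V `<=` U).
Fact spec_res_is_nmod_morphism : nmod_morphism (spec_res h).
Proof. by split=> [|s t]; apply: lsec_ext. Qed.
Fact spec_res_is_monoid_morphism : monoid_morphism (spec_res h).
Proof. by split=> [|s t]; apply: lsec_ext. Qed.
HB.instance Definition _ := GRing.isNmodMorphism.Build (spec_sec U) (spec_sec V)
  (spec_res h) spec_res_is_nmod_morphism.
HB.instance Definition _ := GRing.isMonoidMorphism.Build (spec_sec U) (spec_sec V)
  (spec_res h) spec_res_is_monoid_morphism.
End Res.

Fact spec_res_id (U : opens X) (h : U `<=` U) s : spec_res h s = s.
Proof. by apply: lsec_ext => p Up; exact: (lfun_irr s). Qed.
Fact spec_res_comp (U V W : opens X) (h : V `<=` U) (k : W `<=` V) (l : W `<=` U) s :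
  spec_res k (spec_res h s) = spec_res l s.
Proof. by apply: lsec_ext => p Up; exact: (lfun_irr s). Qed.
Definition spec_presheaf : ring_presheaf X :=
  @RingPresheaf X (fun U => spec_sec U : comPzRingType)
    (fun U V h => spec_res h : {rmorphism _ -> _}) spec_res_id spec_res_comp.
Lemma spec_is_sheaf : ring_is_sheaf spec_presheaf.
Proof. exact: lsec_sheaf. Qed.

Fact spec_const_subproof (a : A) p : opensT X p ->
  exists (W : opens X) (WU : W `<=` opensT X),
    W p /\ is_fraction W (fun q _ => loc_frac a (@notin1 A q)).
Proof.
by exists (opensT X), (@subset_refl _ _); split=> //; exists a, 1 => q _; exists (@notin1 A q).
Qed.
Definition spec_const (a : A) : spec_presheaf (opensT X) :=
  @LSec X _ is_fraction (opensT X) (fun q _ => loc_frac a (@notin1 A q))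
    (@spec_const_subproof a).
Fact spec_const_is_nmod_morphism : nmod_morphism spec_const.
Proof.
split=> [|a b]; apply: lsec_ext => p ? //=.
by rewrite [RHS](loc_fracD a b (@notin1 A p) (@notin1 A p)); apply: loc_eq => /=; ring.
Qed.
Fact spec_const_is_monoid_morphism : monoid_morphism spec_const.
Proof.
split=> [|a b]; apply: lsec_ext => p ? //=.
by rewrite [RHS](loc_fracM a b (@notin1 A p) (@notin1 A p)); apply: loc_eq => /=; ring.
Qed.
HB.instance Definition _ :=
  GRing.isNmodMorphism.Build A _ spec_const spec_const_is_nmod_morphism.
HB.instance Definition _ :=
  GRing.isMonoidMorphism.Build A _ spec_const spec_const_is_monoid_morphism.
End StructureSheaf.

Record ringed_space := RingedSpace {
  rs_top :> topologicalType;
  rs_O : ring_presheaf rs_top;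
  rs_sheaf : ring_is_sheaf rs_O }.

Definition spec_rs (A : comPzRingType) : ringed_space := RingedSpace (@spec_is_sheaf A).

Definition opens_pre (X Y : topologicalType) (f : X -> Y) (cf : continuous f)
  (V : opens Y) : opens X := Opens ((continuousP f).1 cf V (opens_open V)).

Record rs_mor (X Y : ringed_space) := RsMor {
  rsm_fun :> X -> Y;
  rsm_cont : continuous rsm_fun;
  rsm_sharp : forall V : opens Y, {rmorphism rs_O Y V -> rs_O X (opens_pre rsm_cont V)};
  rsm_nat : forall (V W : opens Y) (h : W `<=` V)
      (k : opens_pre rsm_cont W `<=` opens_pre rsm_cont V) s,
    ring_res k (rsm_sharp V s) = rsm_sharp W (ring_res h s) }.

Arguments rsm_cont {X Y} r.
Arguments rsm_sharp {X Y} r V.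

Definition rs_iso (X Y : ringed_space) (f : rs_mor X Y) : Prop :=
  [/\ bijective f, forall W : set X, open W -> open (f @` W)
    & forall V : opens Y, bijective (rsm_sharp f V)].

(* The open subspace U: its sections over W are the sections over the image
   of W under the inclusion. *)
Section Restriction.
Variables (X : topologicalType) (U : opens X).
Local Notation XU := (set_type U : topologicalType).

Fact opens_img_subproof (W : opens XU) : open (val @` W : set X).
Proof.
have [V oV VW] := opens_open W.
have -> : val @` (W : set XU) = V `&` U.
  rewrite -VW; apply/seteqP; split=> [_ [y Vy <-]|x [Vx Ux]].
    by split=> //; exact: set_valP.
  by exists (exist _ x (mem_set Ux)).
exact: openI oV (opens_open U).
Qed.
Definition opens_img (W : opens XU) : opens X := Opens (opens_img_subproof W).
Lemma opens_imgS (V W : opens XU) : V `<=` W -> opens_img V `<=` opens_img W.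
Proof. exact: image_subset. Qed.

Lemma opens_eq (Y : topologicalType) (V W : opens Y) : (V : set Y) = W -> V = W.
Proof.
by case: V W => [V oV] [W oW] /= e; subst W; congr Opens; exact: Prop_irrelevance.
Qed.

Lemma val_cont : continuous (val : XU -> X).
Proof. exact: initial_continuous. Qed.

Lemma restrict_sheaf_axiom (F : opens X -> Type)
  (res : forall V W : opens X, W `<=` V -> F V -> F W) :
  sheaf_axiom res ->
  sheaf_axiom (fun (V W : opens XU) h => @res (opens_img V) (opens_img W) (opens_imgS h)).
Proof.
move=> Fsh W I V VW cov s comp.
have [||t [tP tu]] := Fsh (opens_img W) I (fun i => opens_img (V i))
  (fun i => opens_imgS (VW i)) _ s.
- by move=> _ [y Wy <-]; have [i _ Vy] := cov y Wy; exists i => //; exists y.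
- move=> i j Z; pose Z' := opens_pre val_cont Z.
  have Zi k : Z `<=` opens_img (V k) -> Z' `<=` V k.
    by move=> h y /h[z Vz /val_inj <-].
  move=> hi hj; have := comp i j Z' (Zi i hi) (Zi j hj).
  have e : opens_img Z' = Z.
    apply: opens_eq; apply/seteqP; split=> [_ [y Zy <-] //|x Zx].
    by have [y Vy yx] := hi x Zx; exists y => //; rewrite /= yx.
  move: (opens_imgS (Zi i hi)) (opens_imgS (Zi j hj)); rewrite e => hi' hj'.
  by rewrite (Prop_irrelevance hi' hi) (Prop_irrelevance hj' hj).
by exists t; split.
Qed.

Section Mon.
Variable F : mon_presheaf X.
Definition restrict_mon : mon_presheaf XU :=
  @MonPresheaf XU (fun W => F (opens_img W))
    (fun V W h => mon_res (opens_imgS h))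
    (fun W h s => mon_res_id (opens_imgS h) s)
    (fun V W Z h k l s => mon_res_comp (opens_imgS h) (opens_imgS k) (opens_imgS l) s).
Lemma restrict_mon_is_sheaf : mon_is_sheaf F -> mon_is_sheaf restrict_mon.
Proof. exact: restrict_sheaf_axiom. Qed.
End Mon.

Section Ring.
Variable F : ring_presheaf X.
Definition restrict_ring : ring_presheaf XU :=
  @RingPresheaf XU (fun W => F (opens_img W))
    (fun V W h => ring_res (opens_imgS h))
    (fun W h s => ring_res_id (opens_imgS h) s)
    (fun V W Z h k l s => ring_res_comp (opens_imgS h) (opens_imgS k) (opens_imgS l) s).
Lemma restrict_ring_is_sheaf : ring_is_sheaf F -> ring_is_sheaf restrict_ring.
Proof. exact: restrict_sheaf_axiom. Qed.
End Ring.
End Restriction.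

Definition restrict_rs (X : ringed_space) (U : opens X) : ringed_space :=
  RingedSpace (restrict_ring_is_sheaf (U := U) (@rs_sheaf X)).

Definition is_scheme (X : ringed_space) : Prop :=
  forall x : X, exists (U : opens X) (A : comPzRingType)
    (f : rs_mor (restrict_rs U) (spec_rs A)), U x /\ rs_iso f.

Record scheme := Scheme { sch_rs :> ringed_space; sch_affine : is_scheme sch_rs }.

Section SpecScheme.
Variable A : comPzRingType.
Let X := spec_rs A.
Let U := opensT X.
Let XU := restrict_rs U.

Let g : XU -> X := val.
Let cg : continuous g. Proof. exact: val_cont. Qed.
Let gS (V : opens X) : opens_img (opens_pre cg V) `<=` V.
Proof. by move=> _ [y Vy <-]. Qed.
Let gS' (V : opens X) : V `<=` opens_img (opens_pre cg V).
Proof. by move=> x Vx; exists (exist _ x (mem_set I)). Qed.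
Let gsharp (V : opens X) : {rmorphism rs_O X V -> rs_O XU (opens_pre cg V)} :=
  ring_res (@gS V).
Let g_nat (V W : opens X) (h : W `<=` V) (k : opens_pre cg W `<=` opens_pre cg V) s :
  ring_res (r := rs_O XU) k (gsharp V s) = gsharp W (ring_res h s).
Proof.
have l : opens_img (opens_pre cg W) `<=` V by apply: subset_trans h.
transitivity (ring_res (r := rs_O X) l s); last first.
  exact: esym (@ring_res_comp X (rs_O X) _ _ _ h (@gS W) l s).
exact: (@ring_res_comp X (rs_O X) _ _ _ (@gS V) (opens_imgS k) l s).
Qed.
Let gm : rs_mor XU X := RsMor g_nat.

Lemma spec_is_scheme : is_scheme X.
Proof.
move=> x; exists U, A, gm; split=> //; split.
- exists (fun x => exist _ x (mem_set I)) => y //.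
  exact: val_inj.
- by move=> W oW; exact: (@opens_img_subproof X U (Opens oW)).
- move=> V; exists (ring_res (r := rs_O X) (@gS' V)) => s.
    exact: etrans (@ring_res_comp X (rs_O X) _ _ _ (@gS V) (@gS' V)
      (@subset_refl _ _) s) (@ring_res_id X (rs_O X) _ _ s).
  exact: etrans (@ring_res_comp X (rs_O X) _ _ _ (@gS' V) (@gS V)
    (@subset_refl _ _) s) (@ring_res_id X (rs_O X) _ _ s).
Qed.
End SpecScheme.

Definition spec (A : comPzRingType) : scheme := Scheme (@spec_is_scheme A).

(* f^# induces local homomorphisms O_(Y, f x) -> O_(X, x): a germ is invertible
   if its image is, invertibility being that of the multiplicative monoid. *)
Record scheme_mor (X Y : scheme) := SchemeMor {
  sm_rs :> rs_mor X Y;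
  sm_local : forall (x : X) (V : opens Y) (Vfx : V (sm_rs x)) (s : rs_O Y V),
    munit (germ (F := mul_presheaf (rs_O X)) (U := opens_pre (rsm_cont sm_rs) V) Vfx
             (rsm_sharp sm_rs V s)) ->
    munit (germ (F := mul_presheaf (rs_O Y)) Vfx s) }.

Record log_structure (X : ringed_space) := LogStructure {
  ls_mon : mon_presheaf X;
  ls_sheaf : mon_is_sheaf ls_mon;
  ls_alpha : mon_mor ls_mon (mul_presheaf (rs_O X));
  ls_log : forall U : opens X, logarithmic (ls_alpha U) }.

Definition ls_iso (X : ringed_space) (L L' : log_structure X) : Prop :=
  exists phi : mon_mor (ls_mon L) (ls_mon L'),
    (forall U : opens X, bijective (phi U)) /\
    (forall (U : opens X) m, ls_alpha L' U (phi U m) = ls_alpha L U m).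

Lemma mul_presheaf_is_sheaf (X : ringed_space) : mon_is_sheaf (mul_presheaf (rs_O X)).
Proof. exact: (@rs_sheaf X). Qed.

Definition assoc_log_structure (X : ringed_space) (N : mon_presheaf X)
    (a : mon_mor N (mul_presheaf (rs_O X))) : log_structure X :=
  LogStructure (sheafify_is_sheaf (G := log_presheaf a))
    (assoc_logarithmic a (@mul_presheaf_is_sheaf X)).

Section ConstPrelog.
Variables (X : ringed_space) (P : nmodType).
Variable f : {additive P -> mulmon (rs_O X (opensT X))}.

(* The constant presheaf may replace the constant sheaf: the associated log
   structure is sheafified. *)
Definition const_presheaf : mon_presheaf X :=
  @MonPresheaf X (fun _ => P) (fun _ _ _ => idfun : {additive _ -> _})
    (fun _ _ _ => erefl) (fun _ _ _ _ _ _ _ => erefl).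

Definition const_prelog_fun (U : opens X) : P -> mulmon (rs_O X U) :=
  mulmon_map (ring_res (@opensTS X U)) \o f.
HB.instance Definition _ U := GRing.Additive.on (const_prelog_fun U).
Fact const_prelog_nat (U V : opens X) (h : V `<=` U) (p : P) :
  const_prelog_fun V p = mulmon_map (ring_res h) (const_prelog_fun U p).
Proof. exact: esym (ring_res_comp (@opensTS X U) h (@opensTS X V) (f p)). Qed.
Definition const_prelog : mon_mor const_presheaf (mul_presheaf (rs_O X)) :=
  @MonMor X const_presheaf (mul_presheaf (rs_O X))
    (fun U => const_prelog_fun U : {additive _ -> _}) const_prelog_nat.
End ConstPrelog.

Definition restrict_ls (X : ringed_space) (L : log_structure X) (U : opens X) :
    log_structure (restrict_rs U) :=
  @LogStructure (restrict_rs U) (restrict_mon U (ls_mon L))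
    (restrict_mon_is_sheaf (U := U) (@ls_sheaf X L))
    (@MonMor _ (restrict_mon U (ls_mon L)) (mul_presheaf (rs_O (restrict_rs U)))
       (fun W => ls_alpha L (opens_img W))
       (fun V W h s => mon_mor_nat (ls_alpha L) (opens_imgS h) s))
    (fun W => @ls_log X L (opens_img W)).

Record log_scheme := LogScheme { lsch :> scheme; lsch_log : log_structure lsch }.

Record log_scheme_mor (X Y : log_scheme) := LogSchemeMor {
  lm_sch :> scheme_mor X Y;
  lm_flat : forall V : opens Y, {additive ls_mon (lsch_log Y) V ->
                ls_mon (lsch_log X) (opens_pre (rsm_cont lm_sch) V)};
  lm_nat : forall (V W : opens Y) (h : W `<=` V)
      (k : opens_pre (rsm_cont lm_sch) W `<=` opens_pre (rsm_cont lm_sch) V) m,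
    mon_res k (lm_flat V m) = lm_flat W (mon_res h m);
  lm_alpha : forall (V : opens Y) m,
    ls_alpha (lsch_log X) _ (lm_flat V m) = rsm_sharp lm_sch V (ls_alpha (lsch_log Y) V m) }.

(* Zariski locally there is an integral monoid Q and a homomorphism from the
   constant sheaf Q to O whose associated log structure is isomorphic to M. *)
Definition quasi_coherent_integral (X : log_scheme) : Prop :=
  forall x : X, exists (U : opens X) (Q : nmodType)
      (b : {additive Q -> mulmon (rs_O (restrict_rs U) (opensT (restrict_rs U)))}),
    [/\ U x, integral_monoid Q
      & ls_iso (assoc_log_structure (const_prelog b)) (restrict_ls (lsch_log X) U)].

Definition spec_log_fun (A : comPzRingType) (M : nmodType) (phi : {additive M -> mulmon A}) :
    M -> mulmon (rs_O (spec_rs A) (opensT (spec_rs A))) :=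
  mulmon_map (@spec_const A) \o phi.
HB.instance Definition _ A M phi := GRing.Additive.on (@spec_log_fun A M phi).

Definition spec_log (A : comPzRingType) (M : nmodType) (phi : {additive M -> mulmon A}) :
    log_scheme :=
  @LogScheme (spec A) (assoc_log_structure (const_prelog (@spec_log_fun A M phi))).

Definition specializes (X : topologicalType) (x' x : X) : Prop := closure [set x'] x.

Fact generic_prime (V : idomainType) : prime_ideal (A := V) [set 0].
Proof.
split=> //=.
- by move=> x y -> ->; rewrite addr0.
- by move=> a x ->; rewrite mulr0.
- by apply/eqP; exact: oner_neq0.
- by move=> x y /eqP; rewrite mulf_eq0 => /orP[] /eqP; [left|right].
Qed.
Definition generic_point (V : idomainType) : spec_pt V := SpecPt (generic_prime V).

Fact closed_prime (V : idomainType) : valuation_ring V ->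
  prime_ideal (A := V) [set a | a \isn't a GRing.unit].
Proof.
move=> hV.
have id (a x : V) : x \isn't a GRing.unit -> a * x \isn't a GRing.unit.
  by apply: contra; rewrite unitrM => /andP[].
have div (x y : V) : x != 0 -> y != 0 -> (exists a, x = a * y) \/ (exists a, y = a * x).
  move=> x0 y0; have x0' : tofrac x != 0 by rewrite tofrac_eq0.
  have y0' : tofrac y != 0 by rewrite tofrac_eq0.
  have /hV[] : tofrac x / tofrac y != 0 by rewrite mulf_neq0 ?invr_eq0.
    move=> [a e]; left; exists a; apply/eqP; rewrite -tofrac_eq tofracM -e.
    by rewrite mulfVK.
  move=> [a e]; right; exists a; apply/eqP; rewrite -tofrac_eq tofracM -e.
  by rewrite invf_div mulfVK.
split=> /=.
- by rewrite unitr0.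
- move=> x y nx ny.
  have [->|x0] := eqVneq x 0; first by rewrite add0r.
  have [->|y0] := eqVneq y 0; first by rewrite addr0.
  have [[a e]|[a e]] := div x y x0 y0.
    by rewrite e -[X in _ + X]mul1r -mulrDl; exact: id.
  by rewrite e -[X in X + _]mul1r -mulrDl; exact: id.
- exact: id.
- by rewrite unitr1.
- by move=> x y; rewrite unitrM negb_and => /orP.
Qed.
(* The maximal ideal of a valuation ring consists of its non-units. *)
Definition closed_point (V : idomainType) (hV : valuation_ring V) : spec_pt V :=
  SpecPt (closed_prime hV).

Fact log_valuation_ringV (V : idomainType) (P : nmodType)
  (phi : {additive P -> mulmon V}) : log_valuation_ring phi -> valuation_ring V.
Proof. by case. Qed.

(* Main.v *)
From HB Require Import structures.
From mathcomp Require Import all_boot all_order all_algebra.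
From mathcomp Require Import ring generic_quotient fraction.
From mathcomp Require Import all_classical topology.
Require Import Defs.

(** Let R be the local ring of X at x and R' the local ring at x', so that the
specialization gives h : R -> R'. Near x the log structure comes from a chart
Q -> O with Q integral, hence from a homomorphism beta : Q -> R. A morphism
Spec (V,P) -> X lifting the specialization can be built from a ring morphism
rho : R -> V that kills exactly the r with h r in the maximal ideal of R' and
reflects units, and a homomorphism psi : Q -> P compatible with rho and beta.

The algebra, gathered in [log_valuation_ring_dominating], goes as follows. Let F
be the face of the q in Q such that h (beta q) is invertible.

- F maps to the units of R'. Some field L over the residue field of R' carries
  a character chi of the whole of Q^gp that extends F -> R' -> L. It is a
  residue field of the group algebra R'[Q^gp], twisted so that the elements of
  F become scalars ([field_with_character]). Enlarging the field cannot be
  avoided: if 2 a = 2 b + f with f in F and a, b not in F, then chi (a - b) is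
  a square root of chi f.
- By Chevalley's extension argument some valuation ring V of L dominates R
  ([dominating_valuation_subring]).
- By Zorn's lemma Q^gp has a submonoid T containing Q and -F, total in the sense
  that g or -g is in T for every g, in which the elements of Q outside F stay
  non-invertible ([valuative_submonoid_exists]).
- The g in T such that either -g is not in T or chi g is in V form a total
  submonoid N of Q^gp: this is a lexicographic refinement of T by the valuation
  of chi. Sending g to chi g when -g is in T and to 0 otherwise gives N -> V,
  and P is its logification. It is valuative because N is total, and its units
  are those of V by construction.

On the geometric side, Spec V -> X factors through an affine chart around x
([local_ring_morphism_spec]). Its image lies in every open neighbourhood U of x,
because all points of Spec V are generizations of the closed one; so the chart
Q -> O on U can be pulled back, and by the universal nature of logification and
sheafification psi induces the morphism of log structures
([log_scheme_morphism_of_chart]). The needed compatibility is that the pullback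
to Spec V of a section of O near x is the constant rho (its germ at x). *)

Set Implicit Arguments.
Unset Strict Implicit.
Unset Printing Implicit Defensive.
Import GRing.Theory.
Local Open Scope classical_set_scope.
Local Open Scope quotient_scope.
Local Open Scope ring_scope.

(** * Maximal closed sets and local rings *)

(** A ternary relation covers at once closure under binary operations and under
families of unary ones: these are the only closure conditions needed below. *)
Definition closed_under (T : Type) (R : T -> T -> T -> Prop) (J : set T) : Prop :=
  forall x y z, R x y z -> J x -> J y -> J z.

(** Each closure condition involves only two elements at a time, so it passes to
unions of chains and Zorn's lemma applies. *)
Lemma maximal_closed_set (T : Type) (R : T -> T -> T -> Prop) (J0 Z : set T) :
  closed_under R J0 -> (forall x, J0 x -> ~ Z x) ->
  exists J : set T, [/\ J0 `<=` J, closed_under R J, forall x, J x -> ~ Z x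
    & forall K : set T, closed_under R K -> J `<=` K -> (forall x, K x -> ~ Z x) ->
      K `<=` J].
Proof.
move=> cJ0 J0Z.
(* The union with J0 makes the condition hold for the empty chain. *)
pose E (X : set T) :=
  closed_under R (J0 `|` X) /\ forall x, (J0 `|` X) x -> ~ Z x.
have [F FE Ftot|J [[cJ JZ] Jmax]] := @Zorn_bigcup T E.
- split=> [x y z Rxyz|x [/J0Z //|[X FX Xx]]]; last by apply: (FE X FX).2; right.
  have sub X : F X -> J0 `|` X `<=` J0 `|` \bigcup_(X in F) X.
    by move=> FX u [|Xu]; [left|right; exists X].
  case=> [J0x|[X FX Xx]] [J0y|[Y FY Yy]].
  + by left; exact: cJ0 Rxyz J0x J0y.
  + by apply: (sub Y) => //; apply: (FE Y FY).1 Rxyz _ _; [left|right].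
  + by apply: (sub X) => //; apply: (FE X FX).1 Rxyz _ _; [right|left].
  + have [XY|YX] := Ftot X Y FX FY.
      by apply: (sub Y) => //; apply: (FE Y FY).1 Rxyz _ _; right => //; exact: XY.
    by apply: (sub X) => //; apply: (FE X FX).1 Rxyz _ _; right => //; exact: YX.
exists (J0 `|` J); split=> // K cK JK KZ x Kx; apply: contrapT => nx.
have J0K : J0 `|` K = K by apply/setUidPr => u ?; apply: JK; left.
apply: (Jmax K); last by rewrite /E J0K.
split=> [u Ju|KJ]; first by apply: JK; right.
by apply: nx; right; exact: KJ.
Qed.

(** Equal to [munit] in [mulmon R], but written with the operations of the ring: the
zero and the sum of [mulmon R] are the one and the product of [R]. *)
Definition invertible (R : comPzRingType) (x : R) : Prop := exists y, x * y = 1.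

(** The non-units of a non-zero ring form an ideal as soon as they are stable under
sums. *)
Definition local_ring (R : comPzRingType) : Prop :=
  ~ invertible (0 : R) /\
  forall x y : R, invertible (x + y) -> invertible x \/ invertible y.

Lemma invertible_mul (R : comPzRingType) (x y : R) :
  invertible (x * y) <-> invertible x /\ invertible y.
Proof.
split=> [xy|[ux uy]]; last exact: (@munitD (mulmon R) x y).
split; first exact: (@munitDl (mulmon R) x y).
by apply: (@munitDl (mulmon R) y x); rewrite addrC.
Qed.

Lemma invertible1 (R : comPzRingType) : invertible (1 : R).
Proof. exact: (@munit0 (mulmon R)). Qed.

Lemma invertible_rmorph (R S : comPzRingType) (f : {rmorphism R -> S}) (x : R) :
  invertible x -> invertible (f x).
Proof. exact: (@munit_add (mulmon R) (mulmon S) (mulmon_map f)). Qed.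

Section Bundle.
Variables (M N : nmodType) (f : M -> N) (fD : nmod_morphism f).
Definition additive_fun & nmod_morphism f := f.
HB.instance Definition _ :=
  GRing.isNmodMorphism.Build M N (additive_fun fD) fD.
End Bundle.

Section RingBundle.
Variables (R S : comPzRingType) (f : R -> S).
Hypotheses (fD : nmod_morphism f) (fM : monoid_morphism f).
Definition rmorph_fun & nmod_morphism f & monoid_morphism f := f.
HB.instance Definition _ :=
  GRing.isNmodMorphism.Build R S (rmorph_fun fD fM) fD.
HB.instance Definition _ :=
  GRing.isMonoidMorphism.Build R S (rmorph_fun fD fM) fM.
End RingBundle.

(** * A field carrying a character *)

(** The field L is a quotient of the algebra of formal sums of k [h], with k in B and
h in G. Such a sum s acts on functions G -> B, where k [h] translates by h and
multiplies by k. In the application c : G -> B is a character of a subgroup,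
extended by zero: then the condition s c = t c identifies the elements of the
subgroup with their scalar values, and the quotient is a twisted group algebra.
Replacing equality by congruence modulo a submodule [N] of functions, maximal among
those that contain the functions with values in the maximal ideal but not c, gives
a residue field of that algebra at once. Working with functions avoids normal
forms, and c 0 = 1 is enough to see that the algebra is not zero modulo the
maximal ideal of B. *)
Section FieldExtension.
Variables (B : comPzRingType) (G : zmodType) (c : G -> B).
Hypotheses (Bloc : local_ring B) (c0 : c 0 = 1).

Definition translate_rule (u v w : G -> B) : Prop :=
  (forall g, w g = u g + v g) \/ exists k h, forall g, w g = k * u (g + h).

(** The functions all of whose values are non-units do not include c, since c 0 = 1;
so some maximal submodule avoiding c contains them. *)
Lemma maximal_submodule_exists : exists N : set (G -> B),
  [/\ forall u, (forall g, ~ invertible (u g)) -> N u,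
      closed_under translate_rule N, ~ N c
    & forall K, closed_under translate_rule K -> N `<=` K -> ~ K c -> K `<=` N].
Proof.
have [||N [N0 cN Nc Nm]] := @maximal_closed_set (G -> B) translate_rule
  [set u | forall g, ~ invertible (u g)] [set c].
- move=> u v w [e|[k [h e]]] Nu Nv g; rewrite e.
    by case/Bloc.2 => [/Nu|/Nv].
  by case/invertible_mul => _ /Nu.
- by move=> u + /= uc; rewrite uc => /(_ 0); rewrite c0; apply; exact: invertible1.
exists N; split=> // [|K cK NK Kc]; first by move=> /Nc; apply.
by apply: Nm => // u Ku /= uc; apply: Kc; rewrite -uc.
Qed.

Variable N : set (G -> B).
Hypotheses (N0 : forall u, (forall g, ~ invertible (u g)) -> N u).
Hypotheses (cN : closed_under translate_rule N) (Nc : ~ N c).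
Hypothesis Nmax : forall K, closed_under translate_rule K -> N `<=` K -> ~ K c -> K `<=` N.

Definition formal_sum : Type := seq (B * G).
HB.instance Definition _ := gen_eqMixin formal_sum.
HB.instance Definition _ := gen_choiceMixin formal_sum.

Definition act (s : formal_sum) (u : G -> B) (g : G) : B := \sum_(x <- s) x.1 * u (g + x.2).

Lemma N_add u v w : (forall g, w g = u g + v g) -> N u -> N v -> N w.
Proof. by move=> e Nu Nv; apply: cN Nu Nv; left. Qed.
Lemma N_act k h u w : (forall g, w g = k * u (g + h)) -> N u -> N w.
Proof. by move=> e Nu; apply: (cN (x := u) (y := u)) => //; right; exists k, h. Qed.
Lemma N_zero w : (forall g, w g = 0) -> N w.
Proof. by move=> e; apply: N0 => g; rewrite e; exact: Bloc.1. Qed.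
Lemma N_zero0 : N (fun=> 0).
Proof. exact: N_zero. Qed.
Lemma N_opp u w : (forall g, w g = - u g) -> N u -> N w.
Proof. by move=> e; apply: (@N_act (-1) 0) => g; rewrite e addr0 mulN1r. Qed.

Lemma N_formal s u w : (forall g, w g = act s u g) -> N u -> N w.
Proof.
elim: s w => [|[k h] s IH] w e Nu.
  by apply: N_zero => g; rewrite e /act big_nil.
apply: (@N_add (fun g => k * u (g + h)) (act s u)).
- by move=> g; rewrite e /act big_cons.
- exact: N_act Nu.
- exact: IH.
Qed.

Definition formal_mul (s t : formal_sum) : formal_sum :=
  [seq (x.1 * y.1, x.2 + y.2) | x <- s, y <- t].
Definition formal_opp (s : formal_sum) : formal_sum := [seq (- x.1, x.2) | x <- s].

Lemma act_cat s t u g : act (s ++ t) u g = act s u g + act t u g.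
Proof. by rewrite /act big_cat. Qed.
Lemma act_opp s u g : act (formal_opp s) u g = - act s u g.
Proof. by rewrite /act big_map -sumrN; apply: eq_bigr => x _; rewrite mulNr. Qed.
Lemma act_mul s t u g : act (formal_mul s t) u g = act s (act t u) g.
Proof.
rewrite /act /formal_mul big_allpairs_dep; apply: eq_bigr => x _.
rewrite mulr_sumr; apply: eq_bigr => y _ /=.
by rewrite addrA mulrA.
Qed.
(** Formal sums act by commuting operators. This is why the class of a product depends
only on the classes of both factors. *)
Lemma act_mulC s t u g : act s (act t u) g = act t (act s u) g.
Proof.
rewrite /act; under eq_bigr do rewrite mulr_sumr.
rewrite exchange_big; apply: eq_bigr => y _.
rewrite mulr_sumr; apply: eq_bigr => x _.
by rewrite mulrCA addrAC.
Qed.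
Lemma act_seq1 k h u g : act [:: (k, h)] u g = k * u (g + h).
Proof. by rewrite /act big_seq1. Qed.
Lemma act_sub s u v g : act s (fun g => u g - v g) g = act s u g - act s v g.
Proof. by rewrite /act -sumrB; apply: eq_bigr => x _; rewrite mulrBr. Qed.

Definition fld_rel (s t : formal_sum) : Prop := N (fun g => act s c g - act t c g).
Fact fld_rel_refl s : fld_rel s s.
Proof. by apply: N_zero => g; rewrite subrr. Qed.
Fact fld_rel_sym s t : fld_rel s t -> fld_rel t s.
Proof. by apply: N_opp => g; rewrite opprB. Qed.
Fact fld_rel_trans s t r : fld_rel s t -> fld_rel t r -> fld_rel s r.
Proof. by apply: N_add => g; rewrite addrA subrK. Qed.

Definition fld : Type := {eq_quot prop_equiv fld_rel_refl fld_rel_sym fld_rel_trans}.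
HB.instance Definition _ := Choice.on fld.
HB.instance Definition _ := Quotient.on fld.

Lemma fldP s t : \pi_fld s = \pi_fld t <-> fld_rel s t.
Proof. exact: prop_quotP. Qed.
Lemma fld_ind (K : fld -> Prop) : (forall x, K (\pi_fld x)) -> forall x, K x.
Proof. by move=> h x; rewrite -[x]reprK. Qed.
Lemma fld_eq s t : (forall g, act s c g = act t c g) -> \pi_fld s = \pi_fld t.
Proof. by move=> e; apply/fldP; apply: N_zero => g; rewrite e subrr. Qed.

Definition fld_add (x y : fld) : fld := \pi_fld (repr x ++ repr y).
Definition fld_mul (x y : fld) : fld := \pi_fld (formal_mul (repr x) (repr y)).
Definition fld_opp (x : fld) : fld := \pi_fld (formal_opp (repr x)).

Lemma fld_addE s t : fld_add (\pi_fld s) (\pi_fld t) = \pi_fld (s ++ t).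
Proof.
apply/fldP; have /fldP := reprK (\pi_fld s); have /fldP := reprK (\pi_fld t).
by apply: N_add => g; rewrite !act_cat; ring.
Qed.
Lemma fld_oppE s : fld_opp (\pi_fld s) = \pi_fld (formal_opp s).
Proof.
apply/fldP; have /fldP := reprK (\pi_fld s).
by apply: N_opp => g; rewrite !act_opp; ring.
Qed.
Lemma fld_mulE s t : fld_mul (\pi_fld s) (\pi_fld t) = \pi_fld (formal_mul s t).
Proof.
apply/fldP; have /fldP := reprK (\pi_fld s); have /fldP := reprK (\pi_fld t).
rewrite /fld_mul; set s' := repr (\pi_fld s); set t' := repr (\pi_fld t).
move=> et es.
apply: (fld_rel_trans (t := formal_mul s' t)).
  by apply: N_formal et => g; rewrite act_sub !act_mul.
by apply: (@N_formal t) es => g; rewrite act_sub !act_mul act_mulC [in X in _ - X]act_mulC.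
Qed.

Fact fld_addA : associative fld_add.
Proof.
by elim/fld_ind=> x; elim/fld_ind=> y; elim/fld_ind=> z; rewrite !fld_addE catA.
Qed.
Fact fld_addC : commutative fld_add.
Proof.
elim/fld_ind=> x; elim/fld_ind=> y; rewrite !fld_addE.
by apply: fld_eq => g; rewrite !act_cat addrC.
Qed.
Fact fld_add0 : left_id (\pi_fld [::]) fld_add.
Proof. by elim/fld_ind=> x; rewrite fld_addE. Qed.
Fact fld_addN : left_inverse (\pi_fld [::]) fld_opp fld_add.
Proof.
elim/fld_ind=> x; rewrite fld_oppE fld_addE.
by apply: fld_eq => g; rewrite act_cat act_opp addNr /act big_nil.
Qed.
HB.instance Definition _ := GRing.isZmodule.Build fld fld_addA fld_addC fld_add0 fld_addN.

Fact fld_mulA : associative fld_mul.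
Proof.
elim/fld_ind=> x; elim/fld_ind=> y; elim/fld_ind=> z; rewrite !fld_mulE.
apply: fld_eq => g; rewrite !act_mul /act; apply: eq_bigr => v _; congr (_ * _).
exact: act_mul.
Qed.
Fact fld_mulC : commutative fld_mul.
Proof.
elim/fld_ind=> x; elim/fld_ind=> y; rewrite !fld_mulE.
by apply: fld_eq => g; rewrite !act_mul act_mulC.
Qed.
Fact fld_mul1 : left_id (\pi_fld [:: (1, 0)]) fld_mul.
Proof.
elim/fld_ind=> x; rewrite fld_mulE.
by apply: fld_eq => g; rewrite act_mul act_seq1 mul1r addr0.
Qed.
Fact fld_mulDl : left_distributive fld_mul fld_add.
Proof.
elim/fld_ind=> x; elim/fld_ind=> y; elim/fld_ind=> z.
by rewrite fld_addE !fld_mulE fld_addE; apply: fld_eq => g; rewrite !(act_cat, act_mul).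
Qed.
Fact fld_1neq0 : \pi_fld [:: (1, 0)] != 0 :> fld.
Proof.
apply/eqP => /fldP H; apply: Nc; apply: (N_add _ H N_zero0) => g.
by rewrite act_seq1 /act big_nil subr0 !addr0 mul1r.
Qed.
HB.instance Definition _ := GRing.Zmodule_isComNzRing.Build fld
  fld_mulA fld_mulC fld_mul1 fld_mulDl fld_1neq0.

(** Maximality of [N]: if s c is not in [N] then [N] and the multiples of s c span a
submodule containing c, and c = u + t s c with u in [N] says that t inverts s. *)
Lemma fld_inv_ex (x : fld) : exists y, if x == 0 then y = 0 else y * x = 1.
Proof.
have [x0|x0] := eqVneq x 0; first by exists 0.
elim/fld_ind: x x0 => s s0.
have Ns : ~ N (act s c).
  move=> Ns; move/eqP: s0; apply; apply/fldP.
  by apply: (N_add _ Ns N_zero0) => g; rewrite /act big_nil subr0 addr0.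
pose K w := exists u t, N u /\ forall g, w g = u g + act t (act s c) g.
have [u [t [Nu e]]] : K c.
  apply: contrapT => Kc; apply: Ns.
  apply: (Nmax (K := K)) => //.
  - move=> v v' w + [u [t [Nu e]]] [u' [t' [Nu' e']]] => -[e2|[k [h e2]]].
      exists (fun g => u g + u' g), (t ++ t'); split; first exact: N_add Nu Nu'.
      by move=> g; rewrite e2 e e' act_cat addrACA.
    exists (fun g => k * u (g + h)), (formal_mul [:: (k, h)] t); split; first exact: N_act Nu.
    by move=> g; rewrite e2 e mulrDr act_mul act_seq1.
  - by move=> u Nu; exists u, [::]; split=> // g; rewrite /act big_nil addr0.
  - exists (fun=> 0), [:: (1, 0)]; split; first exact: N_zero.
    by move=> g; rewrite act_seq1 add0r mul1r addr0.
exists (\pi_fld t); rewrite [LHS]fld_mulE; apply/fldP/fld_rel_sym.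
by apply: (N_add _ Nu N_zero0) => g; rewrite act_seq1 mul1r !addr0 e act_mul addrK.
Qed.
Definition fld_inv (x : fld) : fld := projT1 (cid (fld_inv_ex x)).
Fact fld_mulV x : x != 0 -> fld_inv x * x = 1.
Proof. by rewrite /fld_inv; case: cid => y /=; case: eqP. Qed.
Fact fld_inv0 : fld_inv 0 = 0.
Proof. by rewrite /fld_inv; case: cid => y /=; rewrite eqxx. Qed.
HB.instance Definition _ := GRing.ComNzRing_isField.Build fld fld_mulV fld_inv0.

Definition fld_scalar (k : B) : fld := \pi_fld [:: (k, 0)].
Fact fld_scalar_is_nmod_morphism : nmod_morphism fld_scalar.
Proof.
split=> [|a b]; first by apply: fld_eq => g; rewrite act_seq1 mul0r /act big_nil.
by rewrite [RHS]fld_addE; apply: fld_eq => g; rewrite act_cat !act_seq1 mulrDl.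
Qed.
Fact fld_scalar_is_monoid_morphism : monoid_morphism fld_scalar.
Proof.
split=> // a b.
by rewrite [RHS]fld_mulE; apply: fld_eq => g; rewrite act_mul !act_seq1 !addr0 mulrA.
Qed.
HB.instance Definition _ :=
  GRing.isNmodMorphism.Build B fld fld_scalar fld_scalar_is_nmod_morphism.
HB.instance Definition _ :=
  GRing.isMonoidMorphism.Build B fld fld_scalar fld_scalar_is_monoid_morphism.

Definition fld_char (g : G) : fld := \pi_fld [:: (1, g)].
Lemma fld_char0 : fld_char 0 = 1. Proof. by []. Qed.
Lemma fld_charD g h : fld_char (g + h) = fld_char g * fld_char h.
Proof. by rewrite [RHS]fld_mulE; apply: fld_eq => k; rewrite act_mul !act_seq1 !mul1r addrA. Qed.
(** This is how the character extends the one that c encodes: on its subgroup,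
translation multiplies c by a scalar. *)
Lemma fld_charE h k : (forall g, c (g + h) = k * c g) -> fld_char h = fld_scalar k.
Proof. by move=> e; apply: fld_eq => g; rewrite !act_seq1 mul1r addr0. Qed.
Lemma fld_scalar_eq0 k : ~ invertible k -> fld_scalar k = 0.
Proof.
move=> nk; apply/fldP; apply: N0 => g.
by rewrite act_seq1 /act big_nil subr0 => /invertible_mul[].
Qed.

Lemma fld_character :
  exists (L : fieldType) (iota : {rmorphism B -> L}) (chi : G -> L),
    [/\ chi 0 = 1, forall g h, chi (g + h) = chi g * chi h,
      forall k, ~ invertible k -> iota k = 0
      & forall h k, (forall g, c (g + h) = k * c g) -> chi h = iota k].
Proof.
exists fld, fld_scalar, fld_char; split.
- exact: fld_char0.
- exact: fld_charD.
- exact: fld_scalar_eq0.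
- exact: fld_charE.
Qed.
End FieldExtension.

Lemma field_with_character (B : comPzRingType) (G : zmodType) (c : G -> B) :
  local_ring B -> c 0 = 1 ->
  exists (L : fieldType) (iota : {rmorphism B -> L}) (chi : G -> L),
    [/\ chi 0 = 1, forall g h, chi (g + h) = chi g * chi h,
      forall k, ~ invertible k -> iota k = 0
      & forall h k, (forall g, c (g + h) = k * c g) -> chi h = iota k].
Proof.
move=> Bloc c0; have [N [N0 cN Nc Nmax]] := maximal_submodule_exists Bloc c0.
exact: fld_character Nmax.
Qed.

(** * Valuation rings *)

(** Chevalley's theorem, with a single set as the object of Zorn's lemma: take J
maximal among the subsets of L stable under sums, products and multiplication by
the image of R, containing the image of the maximal ideal of R and not containing
1. The valuation ring is the set of the x with x J included in J. *)
Section Dominating.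
Variables (R : comPzRingType) (L : fieldType) (i : {rmorphism R -> L}).
Hypothesis Rloc : local_ring R.

Definition dom_rule (x y z : L) : Prop :=
  [\/ z = x + y, z = x * y | exists r, z = i r * x].

(** This keeps 1 out of the image of the maximal ideal: if i r = 1 then 1 - r is in the
kernel, hence r is a unit. *)
Lemma local_ker (r : R) : i r = 0 -> ~ invertible r.
Proof.
move=> ir0 [s rs]; have := congr1 i rs; rewrite rmorphM ir0 mul0r rmorph1.
by move/eqP; rewrite eq_sym oner_eq0.
Qed.

Lemma dom_ideal_exists : exists J : set L,
  [/\ forall r, ~ invertible r -> J (i r), closed_under dom_rule J, ~ J 1
    & forall K, closed_under dom_rule K -> J `<=` K -> ~ K 1 -> K `<=` J].
Proof.
have [||J [J0 cJ J1 Jm]] := @maximal_closed_set L dom_rule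
  [set x | exists r, ~ invertible r /\ x = i r] [set 1].
- move=> x y z [->|->|[s ->]] [r [nr ->]] [r' [nr' ey]].
  + by exists (r + r'); rewrite ey rmorphD; split=> // /Rloc.2[].
  + by exists (r * r'); rewrite ey rmorphM; split=> // /invertible_mul[].
  + by exists (s * r); rewrite rmorphM; split=> // /invertible_mul[].
- move=> x [r [nr ->]] /= ir1.
  have : i (1 - r) = 0 by rewrite rmorphB rmorph1 ir1 subrr.
  move/local_ker; apply.
  by have [|//|/nr] := Rloc.2 (1 - r) r; rewrite ?subrK; first exact: invertible1.
exists J; split=> //.
- by move=> r nr; apply: J0; exists r.
- by move=> /J1; apply.
- move=> K cK JK K1; apply: Jm => // x Kx /= x1; apply: K1; by rewrite -x1.
Qed.

Variable J : set L.
Hypotheses (J0 : forall r, ~ invertible r -> J (i r)) (cJ : closed_under dom_rule J).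
Hypotheses (J1 : ~ J 1).
Hypothesis Jmax : forall K, closed_under dom_rule K -> J `<=` K -> ~ K 1 -> K `<=` J.

Lemma J_add x y : J x -> J y -> J (x + y).
Proof. by apply: cJ; apply: Or31. Qed.
Lemma J_mul x y : J x -> J y -> J (x * y).
Proof. by apply: cJ; apply: Or32. Qed.
Lemma J_act r x : J x -> J (i r * x).
Proof. by move=> Jx; apply: (cJ (x := x) (y := x)) => //; apply: Or33; exists r. Qed.
Lemma J_zero : J 0.
Proof. by rewrite -(rmorph0 i); apply: J0; exact: Rloc.1. Qed.
Lemma J_opp x : J x -> J (- x).
Proof. by rewrite -mulN1r -(rmorph1 i) -rmorphN; exact: J_act. Qed.
Lemma J_sum (I : Type) (r : seq I) (F : I -> L) :
  (forall j, J (F j)) -> J (\sum_(j <- r) F j).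
Proof. by move=> JF; elim/big_ind: _ => //; [exact: J_zero | exact: J_add]. Qed.

Definition J_poly (p : {poly L}) : Prop := forall n, J p`_n.

(** 1 cannot be in both J[x] and J[1/x]. Given expressions of 1 of degrees n + 1 in x and
m <= n + 1 in 1/x, the second one rewrites (1 - b) x^(n+1), where b is its constant
term, as a polynomial of degree at most n with coefficients in J. Multiplying the
first one by 1 - b and substituting lowers its degree. *)
Lemma J_poly_excl n m x (p q : {poly L}) : x != 0 ->
  J_poly p -> (size p <= n.+1)%N -> p.[x] = 1 ->
  J_poly q -> (size q <= m.+1)%N -> q.[x^-1] <> 1.
Proof.
have [N nmN] : exists N, (n + m)%N = N by exists (n + m)%N.
elim: N n m x p q nmN => [|N IH] n m x p q nmN x0 Jp sp px Jq sq qx.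
  have n0 : n = 0%N by move/eqP: nmN; rewrite addn_eq0 => /andP[/eqP].
  apply: J1; rewrite -px; move: sp; rewrite n0 => /size1_polyC ->.
  by rewrite hornerC.
wlog mn : n m x p q nmN x0 Jp sp px Jq sq qx / (m <= n)%N => [wl|].
  have [mn|/ltnW mn] := leqP m n; first exact: (wl n m x p q).
  by apply: (wl m n x^-1 q p) => //; rewrite ?invrK ?invr_eq0 // addnC.
case: n nmN sp mn => [|n] nmN sp mn.
  by move: mn; rewrite leqn0 => /eqP m0; rewrite m0 in nmN.
pose a := p`_n.+1; pose b := q`_0.
have Ja : J a by exact: Jp.
have Jb : J b by exact: Jq.
pose p0 := \poly_(j < n.+1) p`_j.
pose p1 := \sum_(j < m) q`_j.+1 *: 'X^(n - j) : {poly L}.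
(* The value of p' at x is b + (1 - b) p(x) = 1, the top term of p being replaced. *)
pose p' := b%:P + (1 - b) *: p0 + a *: p1.
apply: (IH n m x p' q) => //.
- by move: nmN; rewrite addSn => -[].
- move=> k; rewrite !coefD coefC !coefZ.
  apply: J_add; first apply: J_add.
  + by case: (k == 0%N); [exact: Jq | exact: J_zero].
  + rewrite coef_poly; case: (k < n.+1)%N; last by rewrite mulr0; exact: J_zero.
    rewrite mulrBl mul1r; apply: J_add; first exact: Jp.
    by apply/J_opp/J_mul => //; exact: Jp.
  + rewrite coef_sum mulr_sumr; apply: J_sum => j.
    rewrite coefZ coefXn; case: eqP => _; rewrite ?mulr0 ?mulr1; [|exact: J_zero].
    exact: J_mul.
- rewrite !(leq_trans (size_polyD _ _)) // geq_max.
  apply/andP; split.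
    rewrite !(leq_trans (size_polyD _ _)) // geq_max.
    rewrite (leq_trans (size_polyC_leq1 _)) //=.
    by rewrite (leq_trans (size_scale_leq _ _)) // size_poly.
  rewrite (leq_trans (size_scale_leq _ _)) //.
  apply: (leq_trans (size_sum _ _ _)); apply/bigmax_leqP => j _.
  by rewrite (leq_trans (size_scale_leq _ _)) // size_polyXn ltnS leq_subr.
- have qE : x ^+ n.+1 * (1 - b) = p1.[x].
    rewrite -{1}qx (@horner_coef_wide _ m.+1 q) // big_ord_recl expr0 mulr1 addrAC subrr add0r.
    rewrite horner_sum mulr_sumr; apply: eq_bigr => j _.
    rewrite hornerZ hornerXn /= /bump /= add1n exprVn mulrCA; congr (_ * _).
    have jn : (j <= n)%N by rewrite -ltnS (leq_trans (ltn_ord j)).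
    by rewrite -subSS expfB_cond // (negbTE x0).
  have pE : p0.[x] + a * x ^+ n.+1 = 1.
    by rewrite -px (@horner_coef_wide _ n.+2 p) // big_ord_recr /= horner_poly.
  rewrite !hornerD hornerC !hornerZ -qE -addrA.
  have -> : (1 - b) * p0.[x] + a * (x ^+ n.+1 * (1 - b)) =
    (1 - b) * (p0.[x] + a * x ^+ n.+1) by ring.
  by rewrite pE mulr1 addrC subrK.
Qed.

Definition J_adjoin (x : L) : set L := [set y | exists2 p, J_poly p & y = p.[x]].

Lemma J_adjoin_sub x : J `<=` J_adjoin x.
Proof.
move=> y Jy; exists y%:P; last by rewrite hornerC.
by move=> k; rewrite coefC; case: eqP => // _; exact: J_zero.
Qed.
Lemma J_adjoin_closed x : closed_under dom_rule (J_adjoin x).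
Proof.
move=> y z w [->|->|[r ->]] [p Jp ->] [q Jq ez].
- by exists (p + q); rewrite ?hornerD ?ez // => k; rewrite coefD; exact: J_add.
- exists (p * q); rewrite ?hornerM ?ez // => k; rewrite coefM; apply: J_sum => j.
  exact: J_mul.
- by exists (i r *: p); rewrite ?hornerZ // => k; rewrite coefZ; exact: J_act.
Qed.

Definition J_order : set L := [set x | forall y, J y -> J (x * y)].

(** If 1 is not in J[x] then J[x] = J by maximality, and J[x] contains J x. *)
Lemma J_order_adjoin x : ~ J_adjoin x 1 -> J_order x.
Proof.
move=> H y Jy.
apply: (Jmax (@J_adjoin_closed x) (@J_adjoin_sub x) H); exists (y *: 'X).
  move=> k; rewrite coefZ coefX; case: (k == 1%N); rewrite ?mulr1 // mulr0; exact: J_zero.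
by rewrite hornerZ hornerX mulrC.
Qed.

Lemma J_order_total x : J_order x \/ J_order x^-1.
Proof.
have [->|x0] := eqVneq x 0.
  by left=> y _; rewrite mul0r; exact: J_zero.
apply: contrapT => /not_orP[nx nx'].
have [p Jp px] : J_adjoin x 1 by apply: contrapT => /J_order_adjoin.
have [q Jq qx] : J_adjoin x^-1 1 by apply: contrapT => /J_order_adjoin.
exact: (@J_poly_excl (size p) (size q) x p q).
Qed.

Lemma dominating_subring : exists O : set L,
  [/\ O 1, forall x y, O x -> O y -> O (x - y), forall x y, O x -> O y -> O (x * y),
      forall x, O x \/ O x^-1
    & forall r, O (i r) /\ forall y, O y -> i r * y = 1 -> invertible r].
Proof.
exists J_order; split.
- by move=> y; rewrite mul1r.
- move=> x y Ox Oy z Jz; rewrite mulrBl; apply: J_add; first exact: Ox.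
  by apply: J_opp; exact: Oy.
- by move=> x y Ox Oy z Jz; rewrite -mulrA; apply: Ox; exact: Oy.
- exact: J_order_total.
- move=> r; split=> [y|y Oy ry]; first exact: J_act.
  by apply: contrapT => /J0/Oy; rewrite mulrC ry.
Qed.
End Dominating.

(** O dominates R: a non-unit of R has its image in J, which is stable under O and does
not contain 1, so this image has no inverse in O. *)
Lemma dominating_valuation_subring (R : comPzRingType) (L : fieldType)
    (i : {rmorphism R -> L}) : local_ring R ->
  exists O : set L,
  [/\ O 1, forall x y, O x -> O y -> O (x - y), forall x y, O x -> O y -> O (x * y),
      forall x, O x \/ O x^-1
    & forall r, O (i r) /\ forall y, O y -> i r * y = 1 -> invertible r].
Proof.
move=> Rloc; have [J [J0 cJ J1 Jmax]] := dom_ideal_exists i Rloc.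
exact: dominating_subring J0 cJ J1 Jmax.
Qed.

Lemma fractionE (V : idomainType) (z : {fraction V}) :
  exists a b : V, b != 0 /\ z = tofrac a / tofrac b.
Proof.
elim/quotW: z => x; exists (\n_x), (\d_x); split; first exact: denom_ratioP.
have d0 : tofrac \d_x != 0 by rewrite tofrac_eq0 denom_ratioP.
apply: (mulIf d0); rewrite divfK //.
unlock tofrac; rewrite -[LHS]FracField.pi_mul /=.
rewrite /FracField.mulf !numden_Ratio ?oner_neq0 // mulr1 mulrC.
apply/eqmodP; rewrite /= FracField.equivfE /=.
by rewrite !numden_Ratio ?oner_neq0 ?mulf_neq0 ?denom_ratioP // ?mulr1 mulrC.
Qed.

Section ValuationSubring.
Variables (L : fieldType) (O : set L).
Hypotheses (O1 : O 1) (OB : forall x y, O x -> O y -> O (x - y)).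
Hypotheses (OM : forall x y, O x -> O y -> O (x * y)).
Hypothesis Ototal : forall x, O x \/ O x^-1.

Definition vpred : pred L := fun x => `[< O x >].
Fact vpred_subring : subring_closed vpred.
Proof.
split=> [|x y /asboolP Ox /asboolP Oy|x y /asboolP Ox /asboolP Oy]; apply/asboolP => //.
- exact: OB.
- exact: OM.
Qed.
HB.instance Definition _ := GRing.isSubringClosed.Build L vpred vpred_subring.
Record vsub : Type := VSub { vval : L; vvalP : vpred vval }.
HB.instance Definition _ := [isSub for vval].
HB.instance Definition _ := [Choice of vsub by <:].
HB.instance Definition _ := [SubChoice_isSubComNzRing of vsub by <:].

Lemma vvalM x y : vval (x * y) = vval x * vval y. Proof. by []. Qed.
Lemma vval1 : vval 1 = 1. Proof. by []. Qed.
Lemma vval0 : vval 0 = 0. Proof. by []. Qed.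
Lemma vval_inj : injective vval. Proof. exact: val_inj. Qed.
(** The default value x of [insubd] is the convention for inverses of non-units. *)
Definition vinv (x : vsub) : vsub := insubd x (vval x)^-1.
Lemma vval_inv x : vval (vinv x) = if vpred (vval x)^-1 then (vval x)^-1 else vval x.
Proof. exact: val_insubd. Qed.
Definition vunit : pred vsub := fun x => (x != 0) && vpred (vval x)^-1.
Fact vmulV : {in vunit, left_inverse 1 vinv *%R}.
Proof.
move=> x /andP[x0 Ox]; apply: vval_inj.
by rewrite vvalM vval_inv Ox mulVf.
Qed.
Fact vunitP (x y : vsub) : y * x = 1 -> vunit x.
Proof.
move=> /(congr1 vval); rewrite vvalM vval1 => yx.
have x0 : vval x != 0 by apply/eqP => e; move/eqP: yx; rewrite e mulr0 eq_sym oner_eq0.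
apply/andP; split; first by apply: contraNneq x0 => ->; rewrite vval0.
have -> : (vval x)^-1 = vval y by apply: (mulIf x0); rewrite mulVf.
exact: valP.
Qed.
Fact vinv_out : {in [predC vunit], vinv =1 id}.
Proof.
move=> x; rewrite inE /= negb_and negbK => /orP[/eqP ->|nx].
  by apply: vval_inj; rewrite vval_inv vval0 invr0; case: ifP.
by apply: vval_inj; rewrite vval_inv (negbTE nx).
Qed.
HB.instance Definition _ := GRing.ComNzRing_hasMulInverse.Build vsub vmulV vunitP vinv_out.
Fact vsub_idomain : GRing.integral_domain_axiom vsub.
Proof.
move=> x y /(congr1 vval)/eqP; rewrite vvalM vval0 mulf_eq0.
by case/orP => /eqP h; apply/orP; [left|right]; apply/eqP; apply: vval_inj; rewrite h vval0.
Qed.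
HB.instance Definition _ := GRing.ComUnitRing_isIntegral.Build vsub vsub_idomain.

Lemma vsub_div (a b : vsub) : b != 0 -> O (vval a / vval b) ->
  exists c : vsub, tofrac a / tofrac b = tofrac c.
Proof.
move=> b0 /asboolP Oab; exists (VSub Oab).
have tb0 : tofrac b != 0 by rewrite tofrac_eq0.
have vb0 : vval b != 0 by apply: contra_neq b0 => h; apply: vval_inj; rewrite h.
apply: (mulIf tb0); rewrite (divfK tb0) -[RHS]tofracM.
by apply: congr1; apply: vval_inj; rewrite vvalM (divfK vb0).
Qed.
Lemma vsub_valuation_ring : valuation_ring vsub.
Proof.
move=> z z0; have [a [b [b0 ez]]] := fractionE z.
have a0 : a != 0 by apply: contra_neq z0 => a0; rewrite ez a0 rmorph0 mul0r.
have [Oab|] := Ototal (vval a / vval b).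
  by left; rewrite ez; exact: vsub_div.
by rewrite invf_div => Oba; right; rewrite ez invf_div; exact: vsub_div.
Qed.

HB.instance Definition _ := GRing.isZmodMorphism.Build vsub L vval (fun _ _ => erefl).
HB.instance Definition _ := GRing.isMonoidMorphism.Build vsub L vval (conj erefl (fun _ _ => erefl)).

Lemma valuation_subring_idomain : exists (V : idomainType) (v : {rmorphism V -> L}),
  [/\ injective v, forall x, O x <-> exists a, v a = x & valuation_ring V].
Proof.
exists vsub, vval; split; [exact: vval_inj| |exact: vsub_valuation_ring].
move=> x; split=> [/asboolP Ox|[a <-]]; first by exists (VSub Ox).
by apply/asboolP; case: a.
Qed.
End ValuationSubring.

(** * Valuative monoids *)

Lemma gpE (Q : nmodType) (g : gp Q) : exists a b, g = to_gp a - to_gp b.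
Proof.
elim/gp_ind: g => -[a b]; exists a, b.
by rewrite /to_gp [- _]gp_oppE [RHS]gp_addE /= addr0 add0r.
Qed.

Section Character.
Variables (Q : nmodType) (B : comPzRingType) (b : {additive Q -> mulmon B}).
Hypothesis Qint : integral_monoid Q.

Lemma monoid_mul (q r : Q) : b (q + r) = (b q : B) * (b r : B) :> B.
Proof. exact: (raddfD b q r). Qed.
Lemma monoid_one : b 0 = 1 :> B.
Proof. exact: (raddf0 b). Qed.

(** The character of F^gp induced by b : F -> B^x, where F is the preimage of the units.
Integrality of Q makes it single-valued; [gchar] extends it by zero. *)
Definition gchar_rel (g : gp Q) (y : B) : Prop :=
  exists a c d, [/\ g = to_gp a - to_gp c, invertible (b a : B),
    (b c : B) * d = 1 & y = (b a : B) * d].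

Lemma gchar_uniq g y y' : gchar_rel g y -> gchar_rel g y' -> y = y'.
Proof.
move=> [a [c [d [-> _ cd ->]]]] [a' [c' [d' [e _ cd' ->]]]].
have {}e : a + c' = a' + c.
  by apply: Qint; rewrite !raddfD /= -[to_gp a](subrK (to_gp c)) e addrAC subrK.
have := monoid_mul a c'; rewrite e monoid_mul => {}e.
transitivity (((b a : B) * (b c' : B)) * (d * d')).
  by rewrite mulrACA cd' mulr1.
by rewrite -e (mulrC d) mulrACA cd mulr1.
Qed.

Definition gchar (g : gp Q) : B := xget 0 (gchar_rel g).

Lemma gcharE g y : gchar_rel g y -> gchar g = y.
Proof. by move=> gy; apply: xget_subset1 => // u v; exact: gchar_uniq. Qed.
Lemma gchar0 : gchar 0 = 1.
Proof.
apply: gcharE; exists 0, 0, 1; rewrite subrr monoid_one mulr1; split=> //.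
exact: invertible1.
Qed.
(** The formula also holds where both sides are 0, as F^gp is stable under translation
by F. *)
Lemma gchar_shift q : invertible (b q : B) ->
  forall g, gchar (g + to_gp q) = (b q : B) * gchar g.
Proof.
move=> bq g; have [[y gy]|N] := pselect (exists y, gchar_rel g y).
  rewrite (gcharE gy); apply: gcharE.
  case: gy => a [c [d [-> ba cd ->]]]; exists (q + a), c, d.
  rewrite monoid_mul raddfD /= mulrA; split=> //; last by apply/invertible_mul; split.
  by rewrite addrC addrA.
have Nq y : ~ gchar_rel (g + to_gp q) y.
  move=> [a [c [d [e ba cd ey]]]]; apply: N.
  have [r qr] := bq; exists ((b a : B) * (d * r)), a, (c + q), (d * r); split=> //.
    by rewrite (raddfD (@to_gp Q)) opprD addrA -e addrK.
  by rewrite monoid_mul mulrACA cd qr mulr1.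
rewrite /gchar (xgetPN _ Nq) xgetPN ?mulr0 // => y gy.
by apply: N; exists y.
Qed.

(** Take T maximal among the submonoids that contain Q and -F and do not contain -q for
any q in Q outside F; integrality of Q and the fact that F is a face ensure that
Q - F is one. If neither g nor -g is in T, adjoining either one produces forbidden
elements: -q = t + n g and -q' = t' - n' g with n, n' > 0. Eliminating g puts
-(n' q) in T, so that n' q, hence q, is in F. *)
Lemma valuative_submonoid_exists : exists T : set (gp Q),
  [/\ forall q, T (to_gp q), forall q, invertible (b q : B) -> T (- to_gp q),
    forall g h, T g -> T h -> T (g + h), forall q, T (- to_gp q) -> invertible (b q : B)
    & forall g, T g \/ T (- g)].
Proof.
have [||T [T0 cT TZ Tmax]] := @maximal_closed_set (gp Q) (fun x y z => z = x + y)
  [set g | exists q f, invertible (b f : B) /\ g = to_gp q - to_gp f]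
  [set g | exists q, ~ invertible (b q : B) /\ g = - to_gp q].
- move=> _ _ _ -> [q [f [bf ->]]] [q' [f' [bf' ->]]]; exists (q + q'), (f + f').
  rewrite monoid_mul !(raddfD (@to_gp Q)) opprD addrACA; split=> //.
  by apply/invertible_mul.
- move=> _ [q [f [bf ->]]] [q' [nq' e]]; apply: nq'.
  have e' : q + q' = f by apply: Qint; rewrite (raddfD (@to_gp Q)); apply/eqP; rewrite -subr_eq0 addrAC e addNr.
  by move: bf; rewrite -e' monoid_mul => /invertible_mul[].
have TD g h : T g -> T h -> T (g + h) by apply: cT.
have TQ q : T (to_gp q).
  by apply: T0; exists q, 0; rewrite monoid_one (raddf0 (@to_gp Q)) subr0; split=> //; exact: invertible1.
have TF q : T (- to_gp q) -> invertible (b q : B).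
  by move=> Tq; apply: contrapT => nq; apply: (TZ _ Tq); exists q.
have T00 : T 0 by rewrite -(raddf0 (@to_gp Q)); exact: TQ.
have Tn g n : T g -> T (g *+ n).
  by move=> Tg; elim: n => [|n IH]; [|rewrite mulrS; exact: TD].
have out g : ~ T g -> exists q t n, [/\ ~ invertible (b q : B), T t, (0 < n)%N
    & - to_gp q = t + g *+ n].
  move=> nTg; apply: contrapT => H; apply: nTg.
  apply: (Tmax [set k | exists t n, T t /\ k = t + g *+ n]).
  - move=> _ _ _ -> [t [n [Tt ->]]] [t' [n' [Tt' ->]]]; exists (t + t'), (n + n')%N.
    by rewrite mulrnDr addrACA; split=> //; exact: TD.
  - by move=> t Tt; exists t, 0%N; rewrite mulr0n addr0.
  - move=> _ [t [n [Tt ->]]] [q [nq e]]; apply: H; exists q, t, n; split=> //.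
    by case: n e => // e; exfalso; apply: nq; apply: TF; rewrite -e mulr0n addr0.
  - by exists 0, 1%N; rewrite add0r mulr1n.
exists T; split=> // [q bq|g].
  by apply: T0; exists 0, q; rewrite (raddf0 (@to_gp Q)) sub0r.
apply: contrapT => /not_orP[/out[q [t [n [nq Tt n0 e]]]] /out[q' [t' [n' [nq' Tt' n0' e']]]]].
have : T (- to_gp (q *+ n')).
  have -> : - to_gp (q *+ n') = t *+ n' + t' *+ n + to_gp (q' *+ n).
    rewrite !(raddfMn (@to_gp Q)) /= -mulNrn e mulrnDl -!mulrnA.
    have -> : to_gp q' = - t' + g *+ n'.
      by apply: oppr_inj; rewrite e' opprD opprK mulNrn.
    by rewrite mulrnDl mulNrn -mulrnA [(n' * n)%N]mulnC -addrA addNKr.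
  exact: TD (TD _ _ (Tn _ _ Tt) (Tn _ _ Tt')) (TQ _).
move/TF; case: n' n0' {e'} => // n' _.
by rewrite mulrS monoid_mul => /invertible_mul[].
Qed.
End Character.

Section LogificationValuative.
Variables (G : zmodType) (N : nmodType) (j : {additive N -> G}).
Hypotheses (jinj : injective j).
Hypothesis jtotal : forall g, (exists n, j n = g) \/ (exists n, j n = - g).
Variables (Q : nmodType) (phi : {additive N -> Q}).

(** A pair (n,v) of unit value phi n + v is identified with (0, phi n + v), as phi n
is then a unit. *)
Lemma log_map_logarithmic : logarithmic (log_map (phi := phi)).
Proof.
move=> u uu; exists (\pi_(logification phi) (LogPair 0 uu)); split.
  by rewrite /= log_mapE /lp_val /= raddf0 add0r.
elim/log_ind=> -[n v vu]; rewrite /= log_mapE /lp_val /= => e.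
apply/logP; exists n, 0; rewrite (raddf0 phi) /= !addr0 add0r [v + _]addrC e.
by split=> //; [apply: (@munitDl _ _ v); rewrite e|exact: munit0].
Qed.

Lemma logification_cancel (x y z : logification phi) : x + z = y + z -> x = y.
Proof.
elim/log_ind: x => x; elim/log_ind: y => y; elim/log_ind: z => z.
rewrite [LHS]log_addE [RHS]log_addE => /logP[q [q' [uq uq' /= e f]]].
apply/logP; exists q, q'; split=> //.
  apply: jinj; apply: (addIr (j (lp_mon z))).
  by rewrite -!raddfD; congr (j _); rewrite addrAC e addrAC.
apply: (munitI (lp_unitP z)).
by rewrite addrAC f addrAC.
Qed.

Lemma logification_integral : integral_monoid (logification phi).
Proof. by move=> x y /gpP[c /=]; rewrite !addr0; exact: logification_cancel. Qed.

(** Modulo units, the group completion of the logification is a quotient of G; so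
comparability in the logification reduces to totality of N in G. *)
Lemma logification_valuative : valuative_monoid (logification phi).
Proof.
split; first exact: logification_integral.
have key (t u t' u' n : _) (hu : munit u) (hu' : munit u') : j n = j t - j t' ->
    exists p, to_gp p = to_gp (\pi_(logification phi) (LogPair t hu))
      - to_gp (\pi_(logification phi) (LogPair t' hu')).
  move=> e; have [v uv] := hu'.
  have hv : munit v by exists u'; rewrite addrC.
  exists (\pi_(logification phi) (LogPair n (munitD hu hv))).
  apply/eqP; rewrite eq_sym subr_eq -raddfD /=; apply/eqP; congr to_gp.
  rewrite [RHS]log_addE; congr (\pi_(logification phi)); apply: log_pair_eq => /=.
    by apply: jinj; rewrite raddfD /= e subrK.
  by rewrite -addrA [v + _]addrC uv addr0.
move=> a; have [x [y ->]] := gpE a.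
elim/log_ind: x => -[t u hu]; elim/log_ind: y => -[t' u' hu'].
have [[n e]|[n e]] := jtotal (j t - j t').
  by left; exact: key e.
by right; rewrite opprB; apply: (@key _ _ _ _ n); rewrite e opprB.
Qed.
End LogificationValuative.

(** * The log valuation ring *)

Section Submonoid.
Variables (G : zmodType) (S : set G).
Hypotheses (S0 : S 0) (SD : forall g h, S g -> S h -> S (g + h)).

Definition spred : pred G := fun g => `[< S g >].
Fact spred_addr_closed : GRing.addr_closed spred.
Proof. by split=> [|g h /asboolP Sg /asboolP Sh]; apply/asboolP => //; exact: SD. Qed.
Record smon : Type := SMon { smval : G; smvalP : spred smval }.
HB.instance Definition _ := [isSub for smval].
HB.instance Definition _ := [Choice of smon by <:].
HB.instance Definition _ := 
  GRing.SubChoice_isSubNmodule.Build G spred smon spred_addr_closed.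
HB.instance Definition _ := GRing.isNmodMorphism.Build smon G smval (conj erefl (fun _ _ => erefl)).

Lemma submonoid_nmod : exists (N : nmodType) (j : {additive N -> G}),
  injective j /\ forall g, S g <-> exists n, j n = g.
Proof.
exists smon, smval; split; first exact: val_inj.
move=> g; split=> [/asboolP Sg|[n <-]]; first by exists (SMon Sg).
by apply/asboolP; case: n.
Qed.
End Submonoid.

(** R and R' play the parts of the local rings at x and at its generization x'; the
conditions on rho place the generic point of Spec V over x' and the closed one over x. *)
Lemma log_valuation_ring_dominating (R R' : comPzRingType) (h : {rmorphism R -> R'})
    (Q : nmodType) (beta : {additive Q -> mulmon R}) :
  local_ring R -> local_ring R' -> integral_monoid Q ->
  exists (V : idomainType) (rho : {rmorphism R -> V}) (P : nmodType)
    (phi : {additive P -> mulmon V}) (psi : {additive Q -> P}),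
  [/\ log_valuation_ring phi, forall r, rho r = 0 <-> ~ invertible (h r),
      forall r, rho r \is a GRing.unit <-> invertible r
    & forall q, phi (psi q) = rho (beta q)].
Proof.
move=> Rloc R'loc Qint.
pose b : {additive Q -> mulmon R'} := mulmon_map h \o beta.
have [L [i [chi [chi0 chiD i0 chiE]]]] := field_with_character R'loc (gchar0 b Qint).
have chib q : invertible (b q : R') -> chi (to_gp q) = i (b q).
  by move=> bq; apply: chiE => g; exact: gchar_shift.
have chiV g : chi (- g) = (chi g)^-1.
  have e : chi (- g) * chi g = 1 by rewrite -chiD addNr.
  have c0 : chi g != 0 by apply/eqP => c0; move/eqP: e; rewrite c0 mulr0 eq_sym oner_eq0.
  by apply: (mulIf c0); rewrite e mulVf.
have [T [TQ TNF TD TF Ttot]] := valuative_submonoid_exists b Qint.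
have T0 : T 0 by rewrite -(raddf0 (@to_gp Q)); exact: TQ.
have [O [O1 OB OM Otot Oi]] := dominating_valuation_subring (i \o h : {rmorphism R -> L}) Rloc.
have [V [v [vinj vO vV]]] := valuation_subring_idomain O1 OB OM Otot.
(* S refines T by the valuation of chi, where T does not decide. *)
pose S g := T g /\ (T (- g) -> O (chi g)).
have S0 : S 0 by split=> // _; rewrite chi0.
have SD g k : S g -> S k -> S (g + k).
  move=> [Tg Og] [Tk Ok]; split=> [|Tn]; first exact: TD.
  rewrite chiD; apply: OM; [apply: Og|apply: Ok].
    by have := TD _ _ Tn Tk; rewrite opprD subrK.
  by have := TD _ _ Tn Tg; rewrite opprD addrAC addNr add0r.
have [N [j [jinj jS]]] := submonoid_nmod S0 SD.
have Sj n : S (j n) by apply/jS; exists n.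
have jtot g : (exists n, j n = g) \/ (exists n, j n = - g).
  suff [Sg|Sg] : S g \/ S (- g) by [left; apply/jS|right; apply/jS].
  have [Tg|nTg] := pselect (T g); last first.
    by right; split; [have [] := Ttot g|rewrite opprK].
  have [Tng|nTng] := pselect (T (- g)); last by left.
  by have [Og|Og] := Otot (chi g); [left|right; rewrite /S chiV].
have phi_ex n : exists a : V, (T (- j n) -> v a = chi (j n)) /\ (~ T (- j n) -> v a = 0).
  have [Tn|nTn] := pselect (T (- j n)).
    by have /vO[a va] := (Sj n).2 Tn; exists a.
  by exists 0; rewrite rmorph0.
have [f fP] := choice phi_ex.
have f_add : nmod_morphism (f : N -> mulmon V).
  split=> [|m n]; apply: vinj.
    by rewrite (fP 0).1 raddf0 ?oppr0 // chi0 [RHS]rmorph1.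
  rewrite [RHS](rmorphM v).
  have TDE : T (- j (m + n)) <-> T (- j m) /\ T (- j n).
    rewrite raddfD opprD; split=> [Tmn|[]]; last exact: TD.
    split; first by have := TD _ _ Tmn (Sj n).1; rewrite subrK.
    by have := TD _ _ Tmn (Sj m).1; rewrite addrAC addNr add0r.
  have [Tmn|nT] := pselect (T (- j (m + n))).
    have [Tm Tn] := TDE.1 Tmn.
    by rewrite ((fP m).1 Tm) ((fP n).1 Tn) ((fP _).1 Tmn) raddfD chiD.
  rewrite (fP _).2 //; have [Tm|nTm] := pselect (T (- j m)); last first.
    by rewrite (fP m).2 // mul0r.
  by rewrite (fP n).2 ?mulr0 // => Tn; apply: nT; apply/TDE.
pose phi0 : {additive N -> mulmon V} := additive_fun f_add.
have rho_ex r : exists a : V, v a = i (h r) by apply/vO; have [] := Oi r.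
have [g gP] := choice rho_ex.
have g_add : nmod_morphism g.
  by split=> [|x y]; apply: vinj; rewrite ?rmorphD !gP ?rmorph0 ?rmorphD.
have g_mul : monoid_morphism g.
  by split=> [|x y]; apply: vinj; rewrite ?rmorphM !gP ?rmorph1 ?rmorphM.
pose rho : {rmorphism R -> V} := rmorph_fun g_add g_mul.
have SQ q : S (to_gp q).
  split=> // /TF bq; rewrite chib //; have [+ _] := Oi (beta q); exact.
have psi_ex q : exists n, j n = to_gp q by apply/jS; exact: SQ.
have [k kP] := choice psi_ex.
have k_add : nmod_morphism (fun q => \pi_(logification phi0) (LogPair (k q) (munit0 (mulmon V)))).
  split=> [|x y].
    congr (\pi_(logification phi0)); apply: log_pair_eq => //=.
    by apply: jinj; rewrite kP !raddf0.
  rewrite [RHS]log_addE; congr (\pi_(logification phi0)); apply: log_pair_eq => /=.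
    by apply: jinj; rewrite raddfD !kP raddfD.
  by rewrite addr0.
exists V, rho, (logification phi0), (log_map (phi := phi0)), (additive_fun k_add).
split.
- by split=> //; [exact: (@logification_valuative _ _ j jinj jtot _ phi0)|exact: log_map_logarithmic].
- move=> r; split=> [r0 hr|hr].
    have [y e] := hr.
    have := congr1 i e; rewrite rmorphM rmorph1 -gP [g r]r0 rmorph0 mul0r.
    by move/eqP; rewrite eq_sym oner_eq0.
  by apply: vinj; rewrite [LHS]gP i0 // rmorph0.
- move=> r; split=> [ur|[s rs]].
    have [_ H] := Oi r; apply: (H (v (rho r)^-1)); first by apply/vO; exists (rho r)^-1.
    by rewrite /= -gP -rmorphM divrr // rmorph1.
  by apply/unitrPr; exists (rho s); rewrite -rmorphM rs rmorph1.
- move=> q; rewrite [LHS]log_mapE /lp_val /= addr0; apply: vinj.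
  rewrite [RHS]gP -[LHS]/(v (f (k q))).
  (* For q in F both sides are chi q; otherwise b q is a non-unit and i kills it. *)
  have [Tn|nTn] := pselect (T (- j (k q))).
    rewrite (fP _).1 // kP chib //; apply: TF.
    by move: Tn; rewrite kP.
  rewrite (fP _).2 // i0 // => bq; apply: nTn; rewrite kP; exact: TNF.
Qed.

(** * Morphisms of ringed spaces *)

Section UnitNear.
Variables (X : topologicalType) (O : ring_presheaf X).

(** Invertibility of the germ of s at x, in a form that composes well with pullbacks of
sections. *)
Definition unit_near (U : opens X) (s : O U) (x : X) : Prop :=
  exists (W : opens X) (WU : W `<=` U), W x /\ invertible (ring_res WU s).

Lemma germ_unitP (U : opens X) (x : X) (Ux : U x) (s : O U) :
  munit (germ (F := mul_presheaf O) Ux s) <-> unit_near s x.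
Proof.
split=> [[g]|[W [WU [Wx [t st]]]]].
  elim/stalk_ind: g => V Vx t.
  rewrite -(@germ_res _ (mul_presheaf O) _ U (opensI U V) (@opensIl _ _ _) Ux (conj Ux Vx)).
  rewrite -(@germ_res _ (mul_presheaf O) _ V (opensI U V) (@opensIr _ _ _) Vx (conj Ux Vx)).
  rewrite -raddfD => e0.
  have /germP[W [WU [WV [Wx e]]]] :=
    etrans e0 (esym (stalk0E (mul_presheaf O) (conj Ux Vx : opensI U V x))).
  exists W, (subset_trans WU (@opensIl _ _ _)); split=> //.
  exists (ring_res (subset_trans WU (@opensIr _ _ _)) t).
  move: e; rewrite !raddfD raddf0 /=.
  rewrite /mulmon_map => e.
  rewrite -(ring_res_comp (@opensIl _ U V) WU _ s) -(ring_res_comp (@opensIr _ U V) WU _ t).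
  exact: e.
exists (germ (F := mul_presheaf O) Wx t).
rewrite -(germ_res (F := mul_presheaf O) WU Ux Wx) -raddfD.
by apply: etrans (stalk0E (mul_presheaf O) Wx); congr germ; exact: st.
Qed.
End UnitNear.

Definition rs_local (X Y : ringed_space) (f : rs_mor X Y) : Prop :=
  forall (x : X) (V : opens Y) (s : rs_O Y V), V (f x) ->
    unit_near (rsm_sharp f V s) x -> unit_near s (f x).

Section Composition.
Variables (X Y Z : ringed_space) (f : rs_mor X Y) (g : rs_mor Y Z).
Let h : X -> Z := g \o f.
Fact rs_comp_cont : continuous h.
Proof. by move=> x; apply: continuous_comp; exact: rsm_cont. Qed.
Fact rs_comp_sub (V : opens Z) :
  opens_pre rs_comp_cont V `<=` opens_pre (rsm_cont f) (opens_pre (rsm_cont g) V).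
Proof. by []. Qed.
Definition rs_comp_sharp (V : opens Z) :
    {rmorphism rs_O Z V -> rs_O X (opens_pre rs_comp_cont V)} :=
  ring_res (@rs_comp_sub V) \o rsm_sharp f (opens_pre (rsm_cont g) V) \o rsm_sharp g V.
Fact rs_comp_nat (V W : opens Z) (k : W `<=` V)
    (l : opens_pre rs_comp_cont W `<=` opens_pre rs_comp_cont V) s :
  ring_res l (rs_comp_sharp V s) = rs_comp_sharp W (ring_res k s).
Proof.
have k1 : opens_pre (rsm_cont g) W `<=` opens_pre (rsm_cont g) V by move=> y; exact: k.
have k2 : opens_pre (rsm_cont f) (opens_pre (rsm_cont g) W) `<=`
  opens_pre (rsm_cont f) (opens_pre (rsm_cont g) V) by move=> y; exact: k.
have k3 := subset_trans (@rs_comp_sub W) k2.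
rewrite /rs_comp_sharp /= (ring_res_comp _ _ k3) -(rsm_nat k k1) -(rsm_nat k1 k2).
by rewrite (ring_res_comp _ _ k3).
Qed.
Definition rs_comp : rs_mor X Z := RsMor rs_comp_nat.

Lemma rs_comp_local : rs_local f -> rs_local g -> rs_local rs_comp.
Proof.
move=> fl gl x V s Vx [W [WV [Wx u]]]; apply: gl => //; apply: fl => //.
exists W, WV; split=> //; move: u.
by rewrite -(ring_res_comp (@rs_comp_sub V) WV WV).
Qed.
End Composition.

Section Inclusion.
Variables (X : ringed_space) (U : opens X).
Let XU := restrict_rs U.
Fact rs_incl_cont : continuous (val : XU -> X).
Proof. exact: val_cont. Qed.
Fact rs_incl_sub (V : opens X) : opens_img (opens_pre rs_incl_cont V) `<=` V.
Proof. by move=> _ [y Vy <-]. Qed.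
Definition rs_incl_sharp (V : opens X) :
    {rmorphism rs_O X V -> rs_O XU (opens_pre rs_incl_cont V)} :=
  ring_res (r := rs_O X) (@rs_incl_sub V).
Fact rs_incl_nat (V W : opens X) (h : W `<=` V)
    (k : opens_pre rs_incl_cont W `<=` opens_pre rs_incl_cont V) s :
  ring_res (r := rs_O XU) k (rs_incl_sharp V s) = rs_incl_sharp W (ring_res h s).
Proof.
have l := subset_trans (@rs_incl_sub W) h.
transitivity (ring_res (r := rs_O X) l s); last first.
  exact: esym (ring_res_comp h (@rs_incl_sub W) l s).
exact: (ring_res_comp (@rs_incl_sub V) (opens_imgS k) l s).
Qed.
Definition rs_incl : rs_mor XU X := RsMor rs_incl_nat.

Lemma rs_incl_local : rs_local rs_incl.
Proof.
move=> x V s Vx [W [WV [Wx u]]].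
have l := subset_trans (opens_imgS WV) (@rs_incl_sub V).
exists (opens_img W), l; split; first by exists x.
by move: u; rewrite /= (ring_res_comp (r := rs_O X) _ (opens_imgS WV) l).
Qed.
End Inclusion.

Section Inverse.
Variables (X Y : ringed_space) (f : rs_mor X Y) (g : Y -> X).
Hypotheses (fK : cancel f g) (gK : cancel g f).
Hypothesis fopen : forall W : set X, open W -> open (f @` W).
Hypothesis fbij : forall V : opens Y, bijective (rsm_sharp f V).

Fact rs_inv_cont : continuous g.
Proof.
apply/continuousP => W oW.
suff -> : g @^-1` W = f @` W by exact: fopen.
apply/seteqP; split=> [y Wy|_ [x Wx <-]]; last by rewrite /= fK.
by exists (g y).
Qed.
Fact rs_inv_sub (W : opens X) :
  opens_pre (rsm_cont f) (opens_pre rs_inv_cont W) `<=` W.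
Proof. by move=> x; rewrite /= fK. Qed.

Fact rs_inv_ex (W : opens X) (s : rs_O X W) : exists t : rs_O Y (opens_pre rs_inv_cont W),
  rsm_sharp f _ t = ring_res (@rs_inv_sub W) s.
Proof. by have [k _ kK] := fbij (opens_pre rs_inv_cont W); exists (k (ring_res (@rs_inv_sub W) s)). Qed.
Definition rs_inv_fun (W : opens X) (s : rs_O X W) := projT1 (cid (rs_inv_ex s)).
Lemma rs_inv_funE (W : opens X) (s : rs_O X W) :
  rsm_sharp f _ (rs_inv_fun s) = ring_res (@rs_inv_sub W) s.
Proof. exact: projT2 (cid (rs_inv_ex s)). Qed.
Fact rs_inv_nmod (W : opens X) : nmod_morphism (@rs_inv_fun W).
Proof.
split=> [|s t]; apply: (bij_inj (fbij _)); rewrite rs_inv_funE.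
  by rewrite !raddf0.
by rewrite [LHS]raddfD [RHS]raddfD /= !rs_inv_funE.
Qed.
Fact rs_inv_monoid (W : opens X) : monoid_morphism (@rs_inv_fun W).
Proof.
split=> [|s t]; apply: (bij_inj (fbij _)); rewrite rs_inv_funE.
  by rewrite !rmorph1.
by rewrite [LHS]rmorphM [RHS]rmorphM /= !rs_inv_funE.
Qed.
Definition rs_inv_sharp (W : opens X) :
    {rmorphism rs_O X W -> rs_O Y (opens_pre rs_inv_cont W)} :=
  rmorph_fun (@rs_inv_nmod W) (@rs_inv_monoid W).
Lemma rs_inv_sharpE (W : opens X) (s : rs_O X W) :
  rsm_sharp f _ (rs_inv_sharp W s) = ring_res (@rs_inv_sub W) s.
Proof. exact: rs_inv_funE. Qed.
Fact rs_inv_nat (V W : opens X) (h : W `<=` V)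
    (k : opens_pre rs_inv_cont W `<=` opens_pre rs_inv_cont V) s :
  ring_res k (rs_inv_sharp V s) = rs_inv_sharp W (ring_res h s).
Proof.
apply: (bij_inj (fbij _)).
have l : opens_pre (rsm_cont f) (opens_pre rs_inv_cont W) `<=`
  opens_pre (rsm_cont f) (opens_pre rs_inv_cont V) by move=> x; exact: k.
have m := subset_trans l (@rs_inv_sub V).
by rewrite -(rsm_nat k l) !rs_inv_sharpE (ring_res_comp _ _ m) (ring_res_comp _ _ m).
Qed.
Definition rs_inv : rs_mor Y X := RsMor rs_inv_nat.

(** If the pullback of s along the inverse is a unit near y, pulling it back along f
shows that s itself is one near the corresponding point. *)
Lemma rs_inv_local : rs_local rs_inv.
Proof.
move=> y V s Vy [W [WV [Wy u]]].
have l : opens_pre (rsm_cont f) W `<=` opens_pre (rsm_cont f) (opens_pre rs_inv_cont V).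
  by move=> x; exact: WV.
have m := subset_trans l (@rs_inv_sub V).
exists (opens_pre (rsm_cont f) W), m; split; first by rewrite /= gK.
have := invertible_rmorph (rsm_sharp f W) u.
by rewrite -(rsm_nat WV l) /= rs_inv_sharpE (ring_res_comp _ _ m).
Qed.
End Inverse.

Section Corestriction.
Variables (Y X : ringed_space) (f : rs_mor Y X) (U : opens X).
Hypothesis fU : forall y, U (f y).
Let XU := restrict_rs U.
Definition rs_corestr_fun (y : Y) : XU := exist _ (f y) (mem_set (fU y)).
Fact rs_corestr_cont : continuous rs_corestr_fun.
Proof.
apply/continuousP => W oW; have [V oV VW] := oW.
suff -> : rs_corestr_fun @^-1` W = f @^-1` V.
  by apply: (continuousP f).1 => //; exact: rsm_cont.
by rewrite -VW.
Qed.
Fact rs_corestr_sub (V : opens XU) :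
  opens_pre rs_corestr_cont V `<=` opens_pre (rsm_cont f) (opens_img V).
Proof. by move=> y Vy; exists (rs_corestr_fun y). Qed.
Definition rs_corestr_sharp (V : opens XU) :
    {rmorphism rs_O XU V -> rs_O Y (opens_pre rs_corestr_cont V)} :=
  ring_res (@rs_corestr_sub V) \o rsm_sharp f (opens_img V).
Fact rs_corestr_nat (V W : opens XU) (h : W `<=` V)
    (k : opens_pre rs_corestr_cont W `<=` opens_pre rs_corestr_cont V) s :
  ring_res k (rs_corestr_sharp V s) = rs_corestr_sharp W (ring_res (r := rs_O XU) h s).
Proof.
have l : opens_pre (rsm_cont f) (opens_img W) `<=` opens_pre (rsm_cont f) (opens_img V).
  by move=> y; exact: opens_imgS.
have m := subset_trans (@rs_corestr_sub W) l.
rewrite /rs_corestr_sharp /= (ring_res_comp _ _ m).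
by rewrite -(rsm_nat (opens_imgS h) l) (ring_res_comp _ _ m).
Qed.
Definition rs_corestr : rs_mor Y XU := RsMor rs_corestr_nat.
End Corestriction.

(** * Spectra *)

Section PrimeLocalization.
Variables (A : comPzRingType) (p : spec_pt A).

Lemma loc_frac_invertible a b (nb : ~ p b) : invertible (loc_frac a nb) <-> ~ p a.
Proof.
have [p0 pD pM p1 pr] := pt_prime p.
split=> [[y]|na]; last first.
  by exists (loc_frac b na); rewrite loc_fracM; apply: loc_eq; rewrite /= mulr1 mul1r mulrC.
elim/loc_ind: y => -[c d nd]; rewrite [_ * _](loc_fracM a c nb nd) => /locP[u [nu /= e]] pa.
have : p (u * (1 * (b * d))) by rewrite -e mulr1 [a * c]mulrC; exact/pM/pM.
by rewrite mul1r; apply: notinM => //; exact: notinM.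
Qed.

Lemma loc_local_ring : local_ring (loc p).
Proof.
have [p0 pD pM p1 pr] := pt_prime p.
split; first by move/(loc_frac_invertible 0 (@notin1 A p)).1; apply.
move=> x y; elim/loc_ind: x => -[a b nb]; elim/loc_ind: y => -[c d nd].
rewrite [_ + _](loc_fracD a c nb nd) => /loc_frac_invertible nac.
have [pa|na] := pselect (p a); last by left; apply/loc_frac_invertible.
right; apply/loc_frac_invertible => pc; apply: nac.
by apply: pD; rewrite mulrC; exact: pM.
Qed.

Lemma open_generization (W : opens (spec_pt A)) (q : spec_pt A) :
  (q : set A) `<=` p -> W p -> W q.
Proof.
move=> qp; have [E WE] := opens_open W.
by move=> /WE nE; apply/WE => Eq; apply: nE => a /Eq/qp.
Qed.

Fact basic_open_subproof (a : A) : open [set q : spec_pt A | ~ (q : set A) a].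
Proof.
exists [set a] => q; split=> [nq h|nq h]; first by apply: nq; exact: h.
by apply: nq => _ ->.
Qed.
Definition basic_open (a : A) : opens (spec_pt A) := Opens (basic_open_subproof a).
End PrimeLocalization.

Section LocMap.
Variables (A B : comPzRingType) (theta : {rmorphism A -> B}).
Variables (p : spec_pt A) (q : spec_pt B).
Hypothesis qp : forall a, (q : set B) (theta a) -> (p : set A) a.

Definition loc_map_pair (x : loc_pair p) : loc_pair q :=
  @LocPair _ q (theta (lnum x)) (theta (lden x)) (fun h => @ldenP _ _ x (qp h)).
Definition loc_map (x : loc p) : loc q :=
  \pi_(loc q) (loc_map_pair (repr x)).
Lemma loc_mapE x : loc_map (\pi_(loc p) x) = \pi_(loc q) (loc_map_pair x).
Proof.
apply/locP; have /locP[u [nu e]] := reprK (\pi_(loc p) x).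
exists (theta u); split; first by move=> /qp.
by rewrite /= -!rmorphM e.
Qed.
Lemma loc_map_frac a b (nb : ~ (p : set A) b) (nb' : ~ (q : set B) (theta b)) :
  loc_map (loc_frac a nb) = loc_frac (theta a) nb'.
Proof. by rewrite [LHS]loc_mapE; apply: loc_eq. Qed.
Fact loc_map_nmod : nmod_morphism (loc_map).
Proof.
split=> [|x y].
  by rewrite [LHS]loc_mapE; apply: loc_eq; rewrite /= rmorph0 !mul0r.
elim/loc_ind: x => x; elim/loc_ind: y => y.
rewrite [x in loc_map x]loc_addE !loc_mapE [RHS]loc_addE; apply: loc_eq => /=.
by rewrite !(rmorphD, rmorphM).
Qed.
Fact loc_map_monoid : monoid_morphism (loc_map).
Proof.
split=> [|x y].
  by rewrite [LHS]loc_mapE; apply: loc_eq; rewrite /= rmorph1.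
elim/loc_ind: x => x; elim/loc_ind: y => y.
rewrite [x in loc_map x]loc_mulE !loc_mapE [RHS]loc_mulE; apply: loc_eq => /=.
by rewrite !rmorphM.
Qed.
HB.instance Definition _ :=
  GRing.isNmodMorphism.Build (loc p) (loc q) (loc_map) loc_map_nmod.
HB.instance Definition _ :=
  GRing.isMonoidMorphism.Build (loc p) (loc q) (loc_map) loc_map_monoid.
End LocMap.

Section LocConst.
Variables (A : comPzRingType) (p : spec_pt A).
Definition loc_const (a : A) : loc p := loc_frac a (@notin1 A p).
Fact loc_const_nmod : nmod_morphism loc_const.
Proof.
split=> // a b; rewrite [RHS](loc_fracD a b (@notin1 A p) (@notin1 A p)).
by apply: loc_eq => /=; ring.
Qed.
Fact loc_const_monoid : monoid_morphism loc_const.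
Proof.
split=> // a b; rewrite [RHS](loc_fracM a b (@notin1 A p) (@notin1 A p)).
by apply: loc_eq => /=; ring.
Qed.
HB.instance Definition _ := GRing.isNmodMorphism.Build A (loc p) loc_const loc_const_nmod.
HB.instance Definition _ := GRing.isMonoidMorphism.Build A (loc p) loc_const loc_const_monoid.
Lemma loc_const_frac a b (nb : ~ (p : set A) b) :
  loc_frac a nb * loc_const b = loc_const a.
Proof. by rewrite [LHS]loc_fracM; apply: loc_eq => /=; ring. Qed.
End LocConst.

Section SpecMap.
Variables (A B : comPzRingType) (theta : {rmorphism A -> B}).
Let X := spec_rs B.
Let Y := spec_rs A.

Fact spec_map_prime (q : spec_pt B) : prime_ideal (theta @^-1` (q : set B)).
Proof.
have [q0 qD qM q1 qr] := pt_prime q; split=> /=.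
- by rewrite rmorph0.
- by move=> x y qx qy; rewrite rmorphD; exact: qD.
- by move=> a x qx; rewrite rmorphM; exact: qM.
- by rewrite rmorph1.
- by move=> x y; rewrite rmorphM; exact: qr.
Qed.
Definition spec_map_fun (q : X) : Y := SpecPt (spec_map_prime q).
Fact spec_map_cont : continuous spec_map_fun.
Proof.
apply/continuousP => W [E WE]; exists (theta @` E) => q; split.
  move=> /WE nE h; apply: nE => a Ea; apply: h; by exists a.
move=> nE; apply/WE => h; apply: nE => _ [a Ea <-]; exact: h.
Qed.

Definition spec_stalk (q : X) : loc (spec_map_fun q) -> loc q :=
  loc_map (theta := theta) (p := spec_map_fun q) (fun a h => h).
HB.instance Definition _ (q : X) := GRing.RMorphism.on (@spec_stalk q).

Fact spec_map_secP (V : opens Y) (s : rs_O Y V) (q : X) :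
  opens_pre spec_map_cont V q -> exists (W : opens X) (WV : W `<=` opens_pre spec_map_cont V),
    W q /\ @is_fraction _ W (fun r Wr => spec_stalk (lfun s (WV r Wr : V (spec_map_fun r)))).
Proof.
move=> Vq; have [W [WV [Wq [a [b sE]]]]] := lfunP s (Vq : V (spec_map_fun q)).
have l : opens_pre spec_map_cont W `<=` opens_pre spec_map_cont V by move=> r; exact: WV.
exists (opens_pre spec_map_cont W), l; split=> //.
exists (theta a), (theta b) => r Wr; have [nb e] := sE (spec_map_fun r) Wr.
exists nb; rewrite -(@loc_map_frac _ _ theta (spec_map_fun r) r (fun a h => h) a b nb nb) -e.
by congr spec_stalk; exact: lfun_irr.
Qed.
Definition spec_map_sec (V : opens Y) (s : rs_O Y V) : rs_O X (opens_pre spec_map_cont V) :=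
  @LSec _ _ _ (opens_pre spec_map_cont V)
    (fun q (Vq : V (spec_map_fun q)) => spec_stalk (lfun s Vq)) (@spec_map_secP V s).
Fact spec_map_nmod (V : opens Y) : nmod_morphism (@spec_map_sec V).
Proof. by split=> [|s t]; apply: lsec_ext => q Vq; rewrite /= ?raddf0 ?raddfD. Qed.
Fact spec_map_monoid (V : opens Y) : monoid_morphism (@spec_map_sec V).
Proof. by split=> [|s t]; apply: lsec_ext => q Vq; rewrite /= ?rmorph1 ?rmorphM. Qed.
Definition spec_map_sharp (V : opens Y) :
    {rmorphism rs_O Y V -> rs_O X (opens_pre spec_map_cont V)} :=
  rmorph_fun (@spec_map_nmod V) (@spec_map_monoid V).
Fact spec_map_nat (V W : opens Y) (h : W `<=` V)
    (k : opens_pre spec_map_cont W `<=` opens_pre spec_map_cont V) s :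
  ring_res k (spec_map_sharp V s) = spec_map_sharp W (ring_res h s).
Proof. by apply: lsec_ext => q Wq /=; congr spec_stalk; exact: lfun_irr. Qed.
Definition spec_map : rs_mor X Y := RsMor spec_map_nat.

(** Near the image of q write s = a / b. If s becomes a unit in the local ring at q then
theta a is outside q, so b / a inverts s where a does not vanish. *)
Lemma spec_map_local : rs_local spec_map.
Proof.
move=> q V s Vq [W [WV [Wq [t st]]]].
have [W' [W'V [W'q [a [b sE]]]]] := lfunP s (Vq : V (spec_map_fun q)).
have na : ~ (spec_map_fun q : set A) a.
  have [nb e] := sE (spec_map_fun q) W'q.
  have [y yE] : invertible (spec_stalk (lfun s (WV q Wq))).
    exists (lfun t Wq); exact: (congr1 (fun w => lfun w Wq) st).
  have : invertible (loc_frac (theta a) (nb : ~ (q : set B) (theta b))).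
    exists y; rewrite -yE; congr (_ * _).
    rewrite -(@loc_map_frac _ _ theta (spec_map_fun q) q (fun a h => h) a b nb nb) -e.
    by congr spec_stalk; exact: lfun_irr.
  by move/loc_frac_invertible.
pose Z := opensI W' (basic_open a).
have ZV : Z `<=` V by move=> r [/W'V].
have invP r : Z r -> exists (Z' : opens (spec_pt A)) (Z'Z : Z' `<=` Z), Z' r /\
    @is_fraction _ Z' (fun r Zr => loc_frac b (Z'Z r Zr).2).
  move=> Zr; exists Z, (@subset_refl _ _); split=> //; exists b, a => k Zk.
  by exists Zk.2; apply: loc_eq.
pose u : spec_presheaf A Z := @LSec _ _ _ Z (fun r (Zr : Z r) => loc_frac b Zr.2) invP.
exists Z, ZV; split=> //; exists u; apply: lsec_ext => r Zr.
have [nb e] := sE r Zr.1.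
have e' : lfun s (ZV r Zr) = loc_frac a nb by rewrite -e; exact: lfun_irr.
rewrite -[LHS]/(lfun s (ZV r Zr) * loc_frac b Zr.2) e'.
by rewrite loc_fracM; apply: loc_eq; rewrite /=; ring.
Qed.
End SpecMap.

Lemma specializes_open (X : topologicalType) (x' x : X) (W : opens X) :
  specializes x' x -> W x -> W x'.
Proof.
move=> hx Wx; have [_ [/= -> //]] := hx _ (open_nbhs_nbhs (conj (opens_open W) Wx)).
Qed.

(** As G is a homeomorphism onto its image, primes of A can be compared through
specializations in X. *)
Lemma affine_chart (X : scheme) (x : X) :
  exists (U : opens X) (A : comPzRingType) (G : rs_mor (spec_rs A) X),
    [/\ U x, rs_local G, forall z, U z -> exists p, G p = z
      & forall D : opens (spec_rs A), exists W : opens X, forall q, W (G q) <-> D q].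
Proof.
have [U [A [f [Ux [[g fK gK] fop fbij]]]]] := sch_affine x.
exists U, A, (rs_comp (rs_inv fK gK fop fbij) (rs_incl U)); split=> //.
- by apply: rs_comp_local; [exact: rs_inv_local|exact: rs_incl_local].
- by move=> z Uz; exists (f (exist _ z (mem_set Uz))); rewrite /= fK.
- move=> D; exists (opens_img (opens_pre (rsm_cont f) D)) => q /=; split.
    by move=> [y Dy /val_inj e]; move: Dy; rewrite /= e gK.
  by move=> Dq; exists (g q); rewrite //= gK.
Qed.

(** The germ of a section at G p: when G is an affine chart, the local ring of X at G p
is the localization of A at p. *)
Section Evaluation.
Variables (A : comPzRingType) (X : ringed_space) (G : rs_mor (spec_rs A) X) (p : spec_pt A).
Definition ev_fun (W : opens X) (Wp : W (G p)) (s : rs_O X W) : loc p :=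
  lfun (rsm_sharp G W s : spec_sec _) (Wp : opens_pre (rsm_cont G) W p).
Fact ev_nmod (W : opens X) (Wp : W (G p)) : nmod_morphism (ev_fun Wp).
Proof. by rewrite /ev_fun; split=> [|s t]; rewrite ?raddf0 ?raddfD. Qed.
Fact ev_monoid (W : opens X) (Wp : W (G p)) : monoid_morphism (ev_fun Wp).
Proof. by rewrite /ev_fun; split=> [|s t]; rewrite ?rmorph1 ?rmorphM. Qed.
HB.instance Definition _ (W : opens X) (Wp : W (G p)) :=
  GRing.isNmodMorphism.Build (rs_O X W) (loc p) (ev_fun Wp) (ev_nmod Wp).
HB.instance Definition _ (W : opens X) (Wp : W (G p)) :=
  GRing.isMonoidMorphism.Build (rs_O X W) (loc p) (ev_fun Wp) (ev_monoid Wp).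
End Evaluation.

Lemma unit_notin (V : idomainType) (q : spec_pt V) (a : V) :
  (q : set V) a -> a \isn't a GRing.unit.
Proof.
have [_ _ qM q1 _] := pt_prime q.
by move=> qa; apply/negP => ua; apply: q1; rewrite -(mulVr ua); exact: qM.
Qed.

(** R and R' are the local rings at x and x', seen as localizations A_p and A_p' of an affine
chart, and [ev] takes germs at x. The morphism is Spec V -> Spec A -> X. The last
clause holds because a section near p is a fraction a / b on an open set containing p,
hence on one containing all generizations of p, among them the image of Spec V. *)
Lemma local_ring_morphism_spec (X : scheme) (x' x : X) : specializes x' x ->
  exists (R R' : comPzRingType) (h : {rmorphism R -> R'})
    (ev : forall W : opens X, W x -> {rmorphism rs_O X W -> R}),
    [/\ local_ring R, local_ring R'
      & forall (V : idomainType) (hV : valuation_ring V) (rho : {rmorphism R -> V}),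
        (forall r, rho r = 0 <-> ~ invertible (h r)) ->
        (forall r, rho r \is a GRing.unit <-> invertible r) ->
        exists F : rs_mor (spec_rs V) X,
          [/\ rs_local F, F (generic_point V) = x', F (closed_point hV) = x
            & forall (W : opens X) (Wx : W x) (s : rs_O X W),
              rsm_sharp F W s =
              ring_res (r := spec_presheaf V) (@opensTS _ (opens_pre (rsm_cont F) W))
                (spec_const (rho (ev W Wx s)))]].
Proof.
move=> hx; have [U [A [G [Ux Gl Gs Gop]]]] := affine_chart x.
have [p Gp] := Gs x Ux; have [p' Gp'] := Gs x' (specializes_open hx Ux).
have p'p a : (p' : set A) a -> (p : set A) a.
  move=> p'a; apply: contrapT => npa.
  have [W WP] := Gop (basic_open a).
  have : W x' by apply: (specializes_open hx); rewrite -Gp; apply/WP.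
  by rewrite -Gp' => /WP; apply.
subst x x'.
exists (loc p), (loc p'), (loc_map (theta := idfun) p'p : {rmorphism _ -> _}),
  (fun W Wx => ev_fun (G := G) Wx : {rmorphism _ -> _}).
split; [exact: loc_local_ring|exact: loc_local_ring|].
move=> V hV rho rho0 rhou.
pose theta : {rmorphism A -> V} := rho \o (@loc_const A p).
have thu a : theta a \is a GRing.unit <-> ~ (p : set A) a.
  by split=> [/rhou/loc_frac_invertible//|h]; apply/rhou/loc_frac_invertible.
have locE a : invertible (loc_map (theta := idfun) p'p (loc_const p a)) <-> ~ (p' : set A) a.
  rewrite (@loc_map_frac _ _ idfun p p' p'p a 1 _ (@notin1 A p')).
  exact: loc_frac_invertible.
have gen : spec_map theta (generic_point V) = p'.
  apply: spec_pt_eq => a /=; split=> [/rho0 H|p'a].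
    by apply: contrapT => na; apply: H; apply/locE.
  by apply/rho0 => /locE; apply.
have clo : spec_map theta (closed_point hV) = p.
  apply: spec_pt_eq => a /=; split=> [nu|pa].
    by apply: contrapT => na; move/negP: nu; apply; apply/thu.
  by apply/negP => /thu; apply.
exists (rs_comp (spec_map theta) G); split.
- by apply: rs_comp_local => //; exact: spec_map_local.
- by rewrite -gen.
- by rewrite -[in RHS]clo.
- move=> W Wx s; apply: lsec_ext => q Wq.
  have [W0 [W0W [W0p [a [b sE]]]]] := lfunP (rsm_sharp G W s : spec_sec _) (Wx : opens_pre (rsm_cont G) W p).
  (* The image of q is a generization of p. *)
  have W0q : W0 (spec_map_fun theta q).
    apply: open_generization W0p => c /unit_notin /negP nu.
    by apply: contrapT => nc; apply: nu; apply/thu.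
  have [nb ep] := sE p W0p; have [nb' eq] := sE _ W0q.
  have evE : ev_fun Wx s = loc_frac a nb by rewrite -ep /ev_fun; exact: lfun_irr.
  rewrite [RHS]/= evE.
  transitivity (spec_stalk (loc_frac a nb')).
    by rewrite -eq /=; congr spec_stalk; exact: lfun_irr.
  rewrite [LHS](@loc_map_frac _ _ theta (spec_map_fun theta q) q (fun a h => h) a b nb' nb').
  apply: loc_eq; rewrite /= mulr1.
  by rewrite -rmorphM loc_const_frac.
Qed.

(** * Pulling back log structures *)

Section Pullback.
Variables (Y Z : topologicalType) (g : Y -> Z) (cg : continuous g).

(** The families m are the morphisms from A to the direct image of B. *)
Definition pull_natural (A : mon_presheaf Z) (B : mon_presheaf Y)
    (m : forall V : opens Z, {additive A V -> B (opens_pre cg V)}) : Prop :=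
  forall (V W : opens Z) (h : W `<=` V) (k : opens_pre cg W `<=` opens_pre cg V) s,
    mon_res k (m V s) = m W (mon_res h s).

Section Stalk.
Variables (A : mon_presheaf Z) (B : mon_presheaf Y).
Variables (m : forall V : opens Z, {additive A V -> B (opens_pre cg V)}).
Hypothesis m_nat : pull_natural m.

Definition stalk_pull (y : Y) (t : stalk A (g y)) : stalk B y :=
  germ (gmem (repr t) : opens_pre cg (gdom (repr t)) y) (m _ (gsec (repr t))).
Lemma stalk_pullE y (V : opens Z) (Vy : V (g y)) s :
  stalk_pull (germ Vy s) = germ (Vy : opens_pre cg V y) (m V s).
Proof.
have /prop_quotP[W [Wg [WV [Wx e]]]] := reprK (germ Vy s).
have kg : opens_pre cg W `<=` opens_pre cg (gdom (repr (germ Vy s))) by move=> z; exact: Wg.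
have kV : opens_pre cg W `<=` opens_pre cg V by move=> z; exact: WV.
apply/germP; exists (opens_pre cg W), kg, kV; split=> //.
by rewrite (m_nat Wg) (m_nat WV) e.
Qed.
Lemma stalk_pullD y (s t : stalk A (g y)) :
  stalk_pull (s + t) = stalk_pull s + stalk_pull t.
Proof.
move: s t; refine (stalk_ind2 _) => U Ux s t.
by rewrite -raddfD !stalk_pullE -raddfD -raddfD.
Qed.
Lemma stalk_pull0 y : stalk_pull (0 : stalk A (g y)) = 0.
Proof. by rewrite [LHS]stalk_pullE !raddf0. Qed.

Fact sheafify_pull_subproof (V : opens Z) (s : sheafify_sec A V) (y : Y) :
  opens_pre cg V y -> exists (W : opens Y) (WV : W `<=` opens_pre cg V),
  W y /\ @is_germs _ B W (fun z Wz => stalk_pull (lfun s (WV z Wz : V (g z)))).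
Proof.
move=> Vy; have [W [WV [Wy [t tE]]]] := lfunP s (Vy : V (g y)).
have l : opens_pre cg W `<=` opens_pre cg V by move=> z; exact: WV.
exists (opens_pre cg W), l; split=> //; exists (m W t) => z Wz.
by rewrite -(stalk_pullE (Wz : W (g z))) -tE; congr stalk_pull; exact: lfun_irr.
Qed.
Definition sheafify_pull_fun (V : opens Z) (s : sheafify_sec A V) :
    sheafify_sec B (opens_pre cg V) :=
  @LSec _ _ _ (opens_pre cg V) (fun y (Vy : V (g y)) => stalk_pull (lfun s Vy))
    (@sheafify_pull_subproof V s).
Fact sheafify_pull_nmod (V : opens Z) : nmod_morphism (@sheafify_pull_fun V).
Proof.
by split=> [|s t]; apply: lsec_ext => y Vy; [exact: stalk_pull0|exact: stalk_pullD].
Qed.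
Definition sheafify_pull (V : opens Z) :
    {additive sheafify A V -> sheafify B (opens_pre cg V)} :=
  additive_fun (@sheafify_pull_nmod V).
Lemma sheafify_pull_natural : pull_natural sheafify_pull.
Proof.
by move=> V W h k s; apply: lsec_ext => y Wy /=; congr stalk_pull; exact: lfun_irr.
Qed.
End Stalk.

(** Pulling back commutes with the structure maps of the sheafifications when it does so
on presheaves, since both sides are determined by their germs. *)
Lemma sheafify_pull_desc (A C : mon_presheaf Z) (B D : mon_presheaf Y)
  (a : mon_mor A C) (b : mon_mor B D)
  (m : forall V : opens Z, {additive A V -> B (opens_pre cg V)})
  (n : forall V : opens Z, {additive C V -> D (opens_pre cg V)})
  (m_nat : pull_natural m) (n_nat : pull_natural n)
  (Csh : mon_is_sheaf C) (Dsh : mon_is_sheaf D) :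
  (forall V s, b _ (m V s) = n V (a V s)) ->
  forall (V : opens Z) (s : sheafify A V),
    sheafify_desc b Dsh _ (sheafify_pull m_nat V s) = n V (sheafify_desc a Csh V s).
Proof.
move=> sq V s; apply: (sheaf_sep Dsh) => y Vy; rewrite [LHS]sheafify_descP /=.
rewrite -(stalk_pullE n_nat (Vy : V (g y))) sheafify_descP.
elim/stalk_ind: (lfun s Vy) => W Wy t.
by rewrite stalk_mapE (stalk_pullE m_nat) (stalk_pullE n_nat) stalk_mapE sq.
Qed.
End Pullback.

Section LogPull.
Variables (Y Z : topologicalType) (g : Y -> Z) (cg : continuous g).
Variables (N G : mon_presheaf Z) (a : mon_mor N G) (N' G' : mon_presheaf Y) (a' : mon_mor N' G').
Variables (n : forall V : opens Z, {additive N V -> N' (opens_pre cg V)}).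
Variables (u : forall V : opens Z, {additive G V -> G' (opens_pre cg V)}).
Hypotheses (n_nat : pull_natural n) (u_nat : pull_natural u).
Hypothesis sq : forall V s, a' _ (n V s) = u V (a V s).

Definition log_pull (V : opens Z) :
    {additive log_presheaf a V -> log_presheaf a' (opens_pre cg V)} :=
  log_fun (f := n V) (g := u V) (@sq V).
Lemma log_pull_natural : pull_natural log_pull.
Proof.
move=> V W h k; elim/log_ind=> x.
rewrite [X in mon_res k X]log_funE [LHS]log_funE [X in log_pull W X]log_funE [RHS]log_funE.
by congr (\pi_(logification (a' _))); apply: log_pair_eq => /=; [exact: n_nat|exact: u_nat].
Qed.
Lemma log_pull_map (V : opens Z) s :
  log_presheaf_map a' _ (log_pull V s) = u V (log_presheaf_map a V s).
Proof.
elim/log_ind: s => x.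
by rewrite /= log_funE !log_mapE /lp_val /= raddfD sq.
Qed.
End LogPull.

Section ChartMorphism.
Variables (X : log_scheme) (V : idomainType) (P : nmodType) (phi : {additive P -> mulmon V}).
Variables (F : rs_mor (spec_rs V) X) (U : opens X) (FU : forall y, U (F y)).
Variables (Q : nmodType) (b : {additive Q -> mulmon (rs_O (restrict_rs U) (opensT (restrict_rs U)))}).
Variable psi : {additive Q -> P}.
Hypothesis bpsi : forall q, rsm_sharp F (opens_img (opensT (restrict_rs U))) (b q) =
  ring_res (r := spec_presheaf V) (@opensTS _ _) (spec_const (phi (psi q))).

Let Z := restrict_rs U.
Let Y := spec_rs V.
Let g : rs_mor Y Z := rs_corestr FU.
Let a := const_prelog b.
Let a' := const_prelog (spec_log_fun phi).

Let n (W : opens Z) : {additive const_presheaf Z Q W -> const_presheaf Y P (opens_pre (rsm_cont g) W)} := psi.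
Let u (W : opens Z) : {additive mul_presheaf (rs_O Z) W -> mul_presheaf (rs_O Y) (opens_pre (rsm_cont g) W)} :=
  mulmon_map (rsm_sharp g W).

Let n_nat : pull_natural n. Proof. by []. Qed.
Let u_nat : pull_natural u. Proof. by move=> W W' h k s; exact: (rsm_nat (r := g) h k s). Qed.
Let sq W q : a' _ (n W q) = u W (a W q).
Proof.
have k : opens_pre (rsm_cont g) W `<=` opens_pre (rsm_cont g) (opensT Z) by [].
have l := subset_trans k (@rs_corestr_sub _ _ _ _ FU (opensT Z)).
transitivity (rsm_sharp g W (ring_res (r := rs_O Z) (@opensTS Z W) (b q))); last by [].
rewrite -(rsm_nat (r := g) (@opensTS Z W) k).
transitivity (ring_res (r := rs_O Y) l (rsm_sharp F (opens_img (opensT Z)) (b q))); last first.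
  exact: esym (ring_res_comp _ k l _).
rewrite bpsi (ring_res_comp _ l (@opensTS _ _)).
by [].
Qed.

Definition chart_pull (W : opens Z) :=
  sheafify_pull (log_pull_natural n_nat u_nat sq) W.

Lemma chart_pull_alpha (W : opens Z) s :
  ls_alpha (assoc_log_structure a') _ (chart_pull W s) =
  rsm_sharp g W (ls_alpha (assoc_log_structure a) W s).
Proof.
apply: (sheafify_pull_desc (n := u)) => //.
exact: log_pull_map.
Qed.
End ChartMorphism.

Lemma mon_mor_inverse (X : topologicalType) (F G : mon_presheaf X) (f : mon_mor F G) :
  (forall U, bijective (f U)) -> exists h : mon_mor G F, forall U s, f U (h U s) = s.
Proof.
move=> fbij.
have ex U (s : G U) : exists t, f U t = s by have [k _ kK] := fbij U; exists (k s).
pose k U s := projT1 (cid (ex U s)).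
have kP U s : f U (k U s) = s := projT2 (cid (ex U s)).
have kD U : nmod_morphism (k U).
  split=> [|s t]; apply: (bij_inj (fbij U)); rewrite kP; first by rewrite raddf0.
  by rewrite raddfD /= !kP.
have kN (U V : opens X) (h : V `<=` U) s : additive_fun (kD V) (mon_res h s) =
    mon_res h (additive_fun (kD U) s).
  by apply: (bij_inj (fbij V)); rewrite [LHS]kP mon_mor_nat; apply: congr1; exact: esym (kP U s).
by exists (MonMor kN) => U s; exact: kP.
Qed.

(** On W, the morphism of log structures restricts a section to the intersection of W
and U, reads it in the chart, and pulls it back along the corestriction of F to U. *)
Lemma log_scheme_morphism_of_chart (X : log_scheme) (V : idomainType) (P : nmodType)
    (phi : {additive P -> mulmon V}) (F : rs_mor (spec_rs V) X) (Fl : rs_local F)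
    (U : opens X) (FU : forall y, U (F y)) (Q : nmodType)
    (b : {additive Q -> mulmon (rs_O (restrict_rs U) (opensT (restrict_rs U)))})
    (psi : {additive Q -> P}) :
  ls_iso (assoc_log_structure (const_prelog b)) (restrict_ls (lsch_log X) U) ->
  (forall q, rsm_sharp F (opens_img (opensT (restrict_rs U))) (b q) =
    ring_res (r := spec_presheaf V) (@opensTS _ _) (spec_const (phi (psi q)))) ->
  exists f : log_scheme_mor (spec_log phi) X, forall y, f y = F y.
Proof.
move=> [iso [iso_bij iso_alpha]] bpsi.
have [inv invP] := mon_mor_inverse iso_bij.
pose L := lsch_log X; pose Y := spec_rs V; pose Z := restrict_rs U.
pose g : rs_mor Y Z := rs_corestr FU.
pose Wof (W : opens X) : opens Z := opens_pre (@rs_incl_cont X U) W.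
pose M : mon_presheaf Y := ls_mon (assoc_log_structure (const_prelog (spec_log_fun phi))).
have sub W : opens_pre (rsm_cont F) W `<=` opens_pre (rsm_cont g) (Wof W) by [].
pose flat W : {additive ls_mon L W -> M (opens_pre (rsm_cont F) W)} :=
  mon_res (m := M) (sub W) \o chart_pull FU bpsi (Wof W) \o inv (Wof W)
  \o mon_res (@rs_incl_sub X U W).
have Floc (x : spec V) (W : opens X) (Wx : W (F x)) (s : rs_O X W) :
  munit (germ (F := mul_presheaf (rs_O (spec V))) (U := opens_pre (rsm_cont F) W) Wx
             (rsm_sharp F W s)) ->
    munit (germ (F := mul_presheaf (rs_O X)) Wx s).
  by move=> /germ_unitP u; apply/germ_unitP; exact: Fl.
pose fs : scheme_mor (spec V) X := @SchemeMor (spec V) X F Floc.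
have flat_nat (W W' : opens X) (h : W' `<=` W)
    (k : opens_pre (rsm_cont F) W' `<=` opens_pre (rsm_cont F) W) m :
  mon_res k (flat W m) = flat W' (mon_res h m).
  have h' : Wof W' `<=` Wof W by move=> y; exact: h.
  have k' : opens_pre (rsm_cont g) (Wof W') `<=` opens_pre (rsm_cont g) (Wof W).
    by move=> y; exact: h.
  have l := subset_trans (sub W') k'.
  have j := subset_trans (opens_imgS h') (@rs_incl_sub X U W).
  rewrite /flat /= (mon_res_comp (m := M) (sub W) k l).
  rewrite -(mon_res_comp (m := M) k' (sub W') l); apply: congr1.
  set t := inv _ (mon_res _ m).
  transitivity (chart_pull FU bpsi (Wof W') (mon_res h' t)).
    exact: sheafify_pull_natural.
  apply: congr1; rewrite /t -(mon_mor_nat inv h'); apply: congr1.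
  rewrite (mon_res_comp (m := ls_mon L) h (@rs_incl_sub X U W') j).
  exact: (mon_res_comp (m := ls_mon L) (@rs_incl_sub X U W) (opens_imgS h') j).
have flat_alpha (W : opens X) m :
  ls_alpha (assoc_log_structure (const_prelog (spec_log_fun phi))) _ (flat W m) =
  rsm_sharp F W (ls_alpha L W m).
  rewrite [LHS](mon_mor_nat (ls_alpha (assoc_log_structure _)) (sub W)).
  rewrite chart_pull_alpha -iso_alpha invP.
  set t := ls_alpha L W m.
  have k : opens_pre (rsm_cont F) (opens_img (Wof W)) `<=` opens_pre (rsm_cont F) W.
    by move=> y; exact: (@rs_incl_sub X U W).
  have l := subset_trans (sub W) (@rs_corestr_sub Y X F U FU (Wof W)).
  have alphaE : ls_alpha (restrict_ls (lsch_log X) U) (Wof W) (mon_res (@rs_incl_sub X U W) m) =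
      ring_res (r := rs_O X) (@rs_incl_sub X U W) t.
    exact: (mon_mor_nat (ls_alpha L) (@rs_incl_sub X U W) m).
  rewrite alphaE.
  transitivity (ring_res (r := rs_O Y) l
    (rsm_sharp F (opens_img (Wof W)) (ring_res (r := rs_O X) (@rs_incl_sub X U W) t))).
    exact: (ring_res_comp (r := rs_O Y)).
  rewrite -(rsm_nat (r := F) (@rs_incl_sub X U W) k).
  rewrite (ring_res_comp (r := rs_O Y) k l (@subset_refl _ _)).
  exact: ring_res_id.
by exists (@LogSchemeMor (spec_log phi) X fs flat flat_nat flat_alpha).
Qed.

Theorem theorem2p15 (X : log_scheme) (hX : quasi_coherent_integral X)
    (x' x : X) (hx : specializes x' x) :
  exists (V : idomainType) (P : nmodType) (phi : {additive P -> mulmon V})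
    (hVP : log_valuation_ring phi) (f : log_scheme_mor (spec_log phi) X),
    f (generic_point V) = x' /\ f (closed_point (log_valuation_ringV hVP)) = x.
Proof.
have [U [Q [b [Ux Qint chart]]]] := hX x.
have [R [R' [h [ev [Rloc R'loc morph]]]]] := local_ring_morphism_spec hx.
have Tx : opens_img (opensT (restrict_rs U)) x by exists (exist _ x (mem_set Ux)).
pose beta : {additive Q -> mulmon R} := mulmon_map (ev _ Tx) \o b.
have [V [rho [P [phi [psi [hVP rho0 rhou phipsi]]]]]] :=
  log_valuation_ring_dominating h beta Rloc R'loc Qint.
have [F [Fl Fgen Fclo Fev]] := morph V (log_valuation_ringV hVP) rho rho0 rhou.
have FU y : U (F y).
  have : opens_pre (rsm_cont F) U y.
    apply: (open_generization (p := closed_point (log_valuation_ringV hVP))).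
      by move=> a; exact: unit_notin.
    by rewrite /= Fclo.
  by [].
have [|f fE] := @log_scheme_morphism_of_chart X V P phi F Fl U FU Q b psi chart.
  by move=> q; rewrite phipsi; exact: Fev.
by exists V, P, phi, hVP, f; rewrite !fE.
Qed.
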